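(* Let $\mathcal{A} = \{\mathbf{a}_1, \ldots, \mathbf{a}_m\} \subset \mathbb{Z}^n$ be a configuration of primitive vectors such that the matrix $A$ whose rows are $\mathbf{a}_1, \ldots, \mathbf{a}_m$ has rank $n$. For $\mathbf{b} \in \mathbb{Z}^m$ let $Q_{\mathbf{b}} = \{\mathbf{x} \in \mathbb{R}^n : A\mathbf{x} \leq \mathbf{b}\}$. Then the following are equivalent. (1) $\mathcal{A}$ is supernormal. (2) Every basis $\mathcal{A}'$ in $\mathcal{A}$ has the property that $\mathcal{A} \cap \mathrm{cone}(\mathcal{A}')$ is a Hilbert basis of $\mathrm{cone}(\mathcal{A}')$, or equivalently, $\mathcal{A} = \mathcal{A}^{(1)}$. (3) Every (regular) triangulation of $\mathcal{A}$ that uses all the vectors is unimodular. (4) For all $\mathbf{b} \in \mathbb{Z}^m$, the system $A\mathbf{x} \leq \mathbf{b}$ is TDI whenever $Q_{\mathbf{b}}$ is tight. (5) For all $\mathbf{b} \in \mathbb{Z}^m$, the polyhedron $Q_{\mathbf{b}}$ is integral whenever $Q_{\mathbf{b}}$ is tight. (6) The small Chvátal rank of $A$ is zero.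
   Context: A vector in $\mathbb{Z}^n$ is primitive if the gcd of its components is one. For a rational polyhedral cone $K$, a Hilbert basis of $K$ is a finite set $\{\mathbf{h}_1,\ldots,\mathbf{h}_t\} \subset K \cap \mathbb{Z}^n$ such that every element of $K \cap \mathbb{Z}^n$ is a nonnegative integer combination of the $\mathbf{h}_i$; a pointed $K$ has a unique minimal Hilbert basis. A basis in a set $\mathcal{V} \subset \mathbb{Z}^n$ is a subset of $n$ linearly independent vectors, and the cone generated by a basis is a basis cone of $\mathcal{V}$. Iterated basis normalization (IBN): $\mathcal{A}^{(0)} := \mathcal{A}$, and for $k \geq 1$, $\mathcal{A}^{(k)}$ is the union of the minimal Hilbert bases of all basis cones of $\mathcal{A}^{(k-1)}$. $A^{(k)}$ denotes a matrix whose rows are the elements of $\mathcal{A}^{(k)}$ (so $A^{(0)}=A$). Let $Q_{\mathbf{b}}^I = \mathrm{conv}(Q_{\mathbf{b}} \cap \mathbb{Z}^n)$. The small Chvátal rank (SCR) of the system $A\mathbf{x} \leq \mathbf{b}$ is the smallest $k$ such that there is an integer vector $\mathbf{b}'$ with $Q_{\mathbf{b}}^I = \{\mathbf{x} : A^{(k)}\mathbf{x} \leq \mathbf{b}'\}$; the SCR of $A$ is the supremum of the SCRs of $A\mathbf{x} \leq \mathbf{b}$ over all $\mathbf{b} \in \mathbb{Z}^m$. $\mathcal{A}$ is supernormal if for every subset $\mathcal{A}' \subseteq \mathcal{A}$, $\mathcal{A} \cap \mathrm{cone}(\mathcal{A}')$ is a Hilbert basis of $\mathrm{cone}(\mathcal{A}')$.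 The system $A\mathbf{x} \leq \mathbf{b}$ (or $Q_{\mathbf{b}}$) is tight if for each $i=1,\ldots,m$ the hyperplane $\{\mathbf{x} : \mathbf{a}_i \cdot \mathbf{x} = b_i\}$ contains an integer point of $Q_{\mathbf{b}}$. The system is totally dual integral (TDI) if for every face $F$ of $Q_{\mathbf{b}}$, the set $\{\mathbf{a}_i \in \mathcal{A} : \mathbf{a}_i \cdot \mathbf{x} = b_i \ \forall \mathbf{x} \in F\}$ is a Hilbert basis of the cone it generates. $Q_{\mathbf{b}}$ is integral if $Q_{\mathbf{b}} = Q_{\mathbf{b}}^I$. A triangulation of $\mathcal{A}$ is a simplicial complex $T$ of subsets of $[m]$ such that the vectors indexed by each member are linearly independent, the simplicial cones generated by the vectors indexed by the members cover $\mathrm{cone}(\mathcal{A})$, and the cones of any two members $\sigma,\tau$ intersect exactly in the cone of $\sigma\cap\tau$. It uses all the vectors if each $i \in [m]$ belongs to some member of $T$. It is unimodular if the vectors indexed by each maximal member form a lattice basis of $\mathbb{Z}^n$. It is regular if there is $\mathbf{w} \in \mathbb{R}^m$ such that $\sigma \in T$ if and only if there is $\mathbf{c} \in \mathbb{R}^n$ with $\mathbf{a}_i \cdot \mathbf{c} = w_i$ for $i \in \sigma$ and $\mathbf{a}_i \cdot \mathbf{c} < w_i$ for $i \notin \sigma$. The parenthetical ''(regular)'' in (3) means that the equivalence holds both for the statement about all triangulations and for the statement about regular triangulations only. *)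

(* Defs.v *)
From HB Require Import structures.
From mathcomp Require Import all_boot all_order all_algebra.
From mathcomp Require Import all_classical all_reals ereal.

Set Implicit Arguments.
Unset Strict Implicit.
Unset Printing Implicit Defensive.

Import Order.TTheory GRing.Theory Num.Theory.
Local Open Scope classical_set_scope.
Local Open Scope ring_scope.

(* Conventions: elements of the configuration are integer row vectors, so that *)
(* they are the rows of A; the points of Q_b are column vectors.               *)

Definition primitive_vec (n : nat) (a : 'rV[int]_n) : Prop :=
  \big[gcdn/0%N]_(j < n) absz (a 0 j) = 1%N.

Definition rows (m n : nat) (A : 'M[int]_(m, n)) : set 'rV[int]_n :=
  range (fun i : 'I_m => row i A).

Definition toR (R : realType) (m n : nat) (M : 'M[int]_(m, n)) : 'M[R]_(m, n) :=
  map_mx intr M.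

Definition conv (R : realType) (V : lmodType R) (S : set V) : set V :=
  [set x | exists (k : nat) (v : 'I_k -> V) (l : 'I_k -> R),
    [/\ forall i, S (v i), forall i, 0 <= l i, \sum_i l i = 1
      & x = \sum_i l i *: v i]].

(* The cone generated by S; it is {0} when S is empty. *)
Definition cone (R : realType) (n : nat) (S : set 'rV[int]_n) : set 'rV[R]_n :=
  [set x | exists (k : nat) (v : 'I_k -> 'rV[int]_n) (l : 'I_k -> R),
    [/\ forall i, S (v i), forall i, 0 <= l i
      & x = \sum_i l i *: toR R (v i)]].

Arguments cone R {n} S.

Definition nat_combinations (n : nat) (S : set 'rV[int]_n) : set 'rV[int]_n :=
  [set z | exists (k : nat) (v : 'I_k -> 'rV[int]_n) (l : 'I_k -> nat),
    (forall i, S (v i)) /\ z = \sum_i v i *+ l i].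

Definition lattice_points (R : realType) (m n : nat) (K : set 'M[R]_(m, n)) :
    set 'M[int]_(m, n) :=
  [set z | K (toR R z)].

Definition hilbert_basis (R : realType) (n : nat)
    (H : set 'rV[int]_n) (K : set 'rV[R]_n) : Prop :=
  [/\ finite_set H, H `<=` lattice_points K
    & lattice_points K `<=` nat_combinations H].

Definition min_hilbert_basis (R : realType) (n : nat)
    (H : set 'rV[int]_n) (K : set 'rV[R]_n) : Prop :=
  hilbert_basis H K /\
  forall H' : set 'rV[int]_n, hilbert_basis H' K -> H' `<=` H -> H' = H.

Definition lin_indep (R : realType) (n : nat) (s : seq 'rV[int]_n) : Prop :=
  free [seq toR R v | v <- s].

Definition basis_in (R : realType) (n : nat) (V B : set 'rV[int]_n) : Prop :=
  B `<=` V /\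
  exists s : seq 'rV[int]_n, [/\ B = [set` s], size s = n & lin_indep R s].

Definition ibn_step (R : realType) (n : nat) (V : set 'rV[int]_n) :
    set 'rV[int]_n :=
  [set h | exists B H : set 'rV[int]_n,
    [/\ basis_in R V B, min_hilbert_basis H (cone R B) & H h]].

Arguments ibn_step R {n} V.

Definition ibn (R : realType) (m n : nat) (A : 'M[int]_(m, n)) (k : nat) :
    set 'rV[int]_n :=
  iter k (ibn_step R) (rows A).

Definition supernormal (R : realType) (n : nat) (V : set 'rV[int]_n) : Prop :=
  forall V' : set 'rV[int]_n, V' `<=` V ->
    hilbert_basis (V `&` lattice_points (cone R V')) (cone R V').

Definition polyhedron (R : realType) (m n : nat)
    (A : 'M[int]_(m, n)) (b : 'cV[int]_m) : set 'cV[R]_n :=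
  [set x | forall i, (toR R A *m x) i 0 <= toR R b i 0].

Arguments polyhedron R {m n} A b.

Definition integer_hull (R : realType) (n : nat) (Q : set 'cV[R]_n) :
    set 'cV[R]_n :=
  conv [set toR R z | z in lattice_points Q].

Definition integral_polyhedron (R : realType) (n : nat) (Q : set 'cV[R]_n) : Prop :=
  Q = integer_hull Q.

Definition tight (R : realType) (m n : nat)
    (A : 'M[int]_(m, n)) (b : 'cV[int]_m) : Prop :=
  forall i, exists z : 'cV[int]_n,
    lattice_points (polyhedron R A b) z /\ (A *m z) i 0 = b i 0.

(* Nonempty faces; c = 0 gives Q itself. *)
Definition face (R : realType) (n : nat) (Q F : set 'cV[R]_n) : Prop :=
  F !=set0 /\
  exists (c : 'rV[R]_n) (d : R),
    (forall x, Q x -> (c *m x) 0 0 <= d) /\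
    F = [set x | Q x /\ (c *m x) 0 0 = d].

Definition active (R : realType) (m n : nat)
    (A : 'M[int]_(m, n)) (b : 'cV[int]_m) (F : set 'cV[R]_n) :
    set 'rV[int]_n :=
  [set a | exists i, a = row i A /\
    forall x, F x -> (toR R A *m x) i 0 = toR R b i 0].

Definition TDI (R : realType) (m n : nat)
    (A : 'M[int]_(m, n)) (b : 'cV[int]_m) : Prop :=
  forall F, face (polyhedron R A b) F ->
    hilbert_basis (active A b F) (cone R (active A b F)).

(* M plays the role of the matrix A^(k), whose row order is irrelevant. *)
Definition describes_hull (R : realType) (m n : nat)
    (A : 'M[int]_(m, n)) (b : 'cV[int]_m) (k : nat) : Prop :=
  exists (p : nat) (M : 'M[int]_(p, n)) (b' : 'cV[int]_p),
    [/\ injective (fun i => row i M), rows M = ibn R A k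
      & integer_hull (polyhedron R A b) = polyhedron R M b'].

(* The infimum of a nonempty set of natural numbers is its least element; it   *)
(* is +oo if no k is suitable.                                                 *)
Definition scr_system (R : realType) (m n : nat)
    (A : 'M[int]_(m, n)) (b : 'cV[int]_m) : \bar R :=
  ereal_inf [set (k%:R)%:E | k in [set k : nat | describes_hull R A b k]].

Definition scr (R : realType) (m n : nat) (A : 'M[int]_(m, n)) : \bar R :=
  ereal_sup (range (fun b : 'cV[int]_m => scr_system R A b)).

Definition subrows (m n : nat) (A : 'M[int]_(m, n)) (s : {set 'I_m}) :
    seq 'rV[int]_n :=
  [seq row i A | i <- enum s].

Definition face_cone (R : realType) (m n : nat)
    (A : 'M[int]_(m, n)) (s : {set 'I_m}) : set 'rV[R]_n :=
  cone R [set` subrows A s].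

Arguments face_cone R {m n} A s.

Definition triangulation (R : realType) (m n : nat)
    (A : 'M[int]_(m, n)) (T : {set {set 'I_m}}) : Prop :=
  [/\ forall s t : {set 'I_m}, s \in T -> t \subset s -> t \in T,
      forall s, s \in T -> lin_indep R (subrows A s),
      cone R (rows A) = \bigcup_(s in [set` T]) face_cone R A s
    & forall s t, s \in T -> t \in T ->
        face_cone R A s `&` face_cone R A t = face_cone R A (s :&: t)%SET].

Definition uses_all (m : nat) (T : {set {set 'I_m}}) : Prop :=
  forall i : 'I_m, exists2 s, s \in T & i \in s.

Definition regular_complex (R : realType) (m n : nat)
    (A : 'M[int]_(m, n)) (T : {set {set 'I_m}}) : Prop :=
  exists w : 'I_m -> R, forall s : {set 'I_m},
    s \in T <-> exists c : 'cV[R]_n,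
      (forall i, i \in s -> (toR R A *m c) i 0 = w i) /\
      (forall i, i \notin s -> (toR R A *m c) i 0 < w i).

Definition lattice_basis (R : realType) (n : nat) (s : seq 'rV[int]_n) : Prop :=
  lin_indep R s /\
  forall z : 'rV[int]_n, exists c : 'I_(size s) -> int,
    z = \sum_i c i *: s`_i.

Definition unimodular (R : realType) (m n : nat)
    (A : 'M[int]_(m, n)) (T : {set {set 'I_m}}) : Prop :=
  forall s, maxset (fun t => t \in T) s -> lattice_basis R (subrows A s).

(* Main.v *)
Require Import Defs.
From HB Require Import structures.
From mathcomp Require Import all_boot all_order all_algebra.
From mathcomp Require Import all_classical all_reals ereal topology.
From mathcomp Require Import ring lra zify.
Import Order.TTheory GRing.Theory Num.Theory.
Local Open Scope classical_set_scope.
Local Open Scope ring_scope.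

Set Implicit Arguments.
Unset Strict Implicit.
Unset Printing Implicit Defensive.

(** Write [a_i] for the rows of [A].  All the conditions are reduced to index
sets [s] of rows and to one statement about them: call a basis [s] empty when
no further row lies in its cone, and consider

  (E)  every empty basis generates the lattice.

(E) implies that the configuration is supernormal.  When some [a_i] lies in
[cone s] without generating a ray, starring [cone s] at [a_i] covers it by
basis cones that contain fewer rows, so induction gives the Hilbert basis
property for all basis cones ([stellar_hilbert]); Caratheodory's theorem then
reaches every cone, because an independent set extends to a basis and spans a
face of its cone ([basis_supernormal]).

Supernormality gives the other conditions.  A simplex of a triangulation that
uses all the rows is an empty basis ([basis_unimodular]).  If the system is
tight, the active rows of a face are exactly the rows in the cone they
generate ([supernormal_TDI]), so the system is TDI; a TDI system has integral
vertices, hence is integral ([TDI_integral]).  Every system can be replaced by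
a tight one with the same lattice points, so integrality of the tight systems
says that the rows of [A] suffice to describe all integer hulls
([integral_describes], [describes_integral]).  Normalization adds nothing
exactly when all basis cones have the Hilbert basis property, since minimal
Hilbert bases of simplicial cones exist, consist of irreducible vectors and
contain the primitive generators of the rays ([ibn1_basis]).

The way back to (E) starts from weights [w] for which an empty basis [s] and
every single row are exposed: some functional [c] satisfies [a_i c = w_i] on
the set and [a_i c < w_i] off it ([empty_basis_weights]).  Both conditions are
open, so generic weights near [w] give a regular triangulation that uses all
the rows and has [s] as a simplex ([regular_unimodular_empty]; that the cells
cover the cone is linear programming duality, [conic_cover]).  On the other
hand, rounding large multiples of [w] gives tight integral right-hand sides
whose polyhedra have a vertex with tight rows [s]; if these vertices are
integral for all roundings, differences of two of them form an integral dual
basis of [s] ([integral_empty_hilbert]). *)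

(** * Coefficient vectors with prescribed support *)

Definition supported (V : nmodType) (m : nat) (s : {set 'I_m}) (l : 'rV[V]_m) :
  Prop := forall i : 'I_m, i \notin s -> l 0 i = 0.

Definition indep (F : fieldType) (m n : nat) (M : 'M[F]_(m, n))
    (s : {set 'I_m}) : Prop :=
  forall l : 'rV[F]_m, supported s l -> l *m M = 0 -> l = 0.

Definition spans (F : fieldType) (m n : nat) (M : 'M[F]_(m, n))
    (s : {set 'I_m}) : Prop :=
  forall x : 'rV[F]_n, exists2 l : 'rV[F]_m, supported s l & x = l *m M.

Lemma supported_sub (V : nmodType) m (s t : {set 'I_m}) (l : 'rV[V]_m) :
  s \subset t -> supported s l -> supported t l.
Proof.
by move=> /fintype.subsetP st sl i it; apply: sl; apply: contra it => /st.
Qed.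

Lemma supported0 (V : nmodType) m (s : {set 'I_m}) :
  supported s (0 : 'rV[V]_m).
Proof. by move=> i _; rewrite mxE. Qed.

Lemma supportedT (V : nmodType) m (l : 'rV[V]_m) : supported [set: 'I_m] l.
Proof. by move=> i; rewrite inE. Qed.

Lemma supportedD (V : nmodType) m (s : {set 'I_m}) (l l' : 'rV[V]_m) :
  supported s l -> supported s l' -> supported s (l + l').
Proof. by move=> sl sl' i si; rewrite mxE sl // sl' // addr0. Qed.

Lemma supportedZ (F : pzRingType) m (s : {set 'I_m}) (a : F) (l : 'rV[F]_m) :
  supported s l -> supported s (a *: l).
Proof. by move=> sl i si; rewrite mxE sl // mulr0. Qed.

Lemma supportedB (F : pzRingType) m (s : {set 'I_m}) (l l' : 'rV[F]_m) :
  supported s l -> supported s l' -> supported s (l - l').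
Proof.
by move=> sl sl'; rewrite -scaleN1r; apply: supportedD => //; apply: supportedZ.
Qed.

Lemma supported_delta (F : pzRingType) m (s : {set 'I_m}) i :
  i \in s -> supported s (delta_mx 0 i : 'rV[F]_m).
Proof.
move=> si j sj; rewrite mxE eqxx /=.
by case: eqP => // ji; rewrite ji si in sj.
Qed.

Section IndexedRows.
Variables (F : fieldType) (m n : nat) (M : 'M[F]_(m, n)).
Implicit Types (s t : {set 'I_m}) (l : 'rV[F]_m) (c : 'cV[F]_n).

Definition subfamily s : 'M[F]_(#|s|, n) := rowsub (@enum_val _ (mem s)) M.

Let ext s : 'M[F]_(#|s|, m) := rowsub (@enum_val _ (mem s)) 1%:M.

Let subfamilyE s : subfamily s = ext s *m M.
Proof. by rewrite /subfamily rowsubE. Qed.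

Let supported_ext s (u : 'rV[F]_#|s|) : supported s (u *m ext s).
Proof.
move=> i si; rewrite !mxE big1 // => k _; rewrite !mxE.
case: eqP => [ki|]; last by rewrite mulr0.
by move: si; rewrite -ki enum_valP.
Qed.

Let extK s l : supported s l -> l = (\row_k l 0 (enum_val k)) *m ext s.
Proof.
move=> sl; apply/rowP => j; rewrite !mxE.
under eq_bigr => k _ do rewrite !mxE.
rewrite -(big_enum_val (fun i : 'I_m => l 0 i * (i == j)%:R)) /=.
case: (boolP (j \in s)) => [js|js].
  rewrite (bigD1 j) //= eqxx mulr1 big1 ?addr0 // => i /andP[_ /negPf ->].
  by rewrite mulr0.
rewrite (sl _ js) big1 // => i si; case: eqP => [ij|]; last by rewrite mulr0.
by rewrite -ij si in js.
Qed.

Let ext_inj s (u : 'rV[F]_#|s|) : u *m ext s = 0 -> u = 0.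
Proof.
move=> u0; apply/rowP => k.
have := congr1 (fun w : 'rV__ => w 0 (enum_val k)) u0; rewrite !mxE => <-.
rewrite (bigD1 k) //= !mxE eqxx mulr1 big1 ?addr0 // => j jk.
by rewrite !mxE (inj_eq enum_val_inj) (negPf jk) mulr0.
Qed.

Lemma indepP s : indep M s <-> row_free (subfamily s).
Proof.
split=> [ind|fr l sl l0].
  rewrite -kermx_eq0; apply/rowV0P => u /sub_kermxP.
  by rewrite subfamilyE mulmxA => /(ind _ (supported_ext u))/ext_inj.
move: l0; have := extK sl; set u := (\row__ _) => ->.
rewrite -mulmxA -subfamilyE => /eqP.
by rewrite mulmx_free_eq0 // => /eqP ->; rewrite mul0mx.
Qed.

Lemma spansP s : spans M s <-> row_full (subfamily s).
Proof.
split=> [sp|/row_fullP[B BM] x].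
  rewrite -sub1mx; apply/row_subP => i.
  have [l sl ->] := sp (row i 1%:M); rewrite (extK sl) -mulmxA -subfamilyE.
  exact: submxMl.
exists (x *m B *m ext s); first exact: supported_ext.
by rewrite -[LHS]mulmx1 -BM subfamilyE !mulmxA.
Qed.

Lemma subfamily_mul s c k : (subfamily s *m c) k 0 = (M *m c) (enum_val k) 0.
Proof. by rewrite !mxE; apply: eq_bigr => j _; rewrite !mxE. Qed.

Lemma indep_card s : indep M s -> (#|s| <= n)%N.
Proof. by move/indepP/eqP => <-; rewrite rank_leq_col. Qed.

Lemma indep_spans s : indep M s -> spans M s <-> #|s| = n.
Proof.
move=> /indepP fr; split=> [/spansP|e].
  by rewrite /row_full (eqP fr) => /eqP.
by apply/spansP; rewrite /row_full (eqP fr) e.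
Qed.

Lemma indep_lift s (d : 'I_m -> F) :
  indep M s -> exists c, forall i, i \in s -> (M *m c) i 0 = d i.
Proof.
move=> /indepP/row_freeP[B MB].
exists (B *m \col_k d (enum_val k)) => i si.
rewrite -(enum_rankK_in si si) -subfamily_mul mulmxA MB mul1mx mxE.
by rewrite enum_rankK_in.
Qed.

Lemma spans_ker s c c' : spans M s ->
  (forall i, i \in s -> (M *m c) i 0 = (M *m c') i 0) -> c = c'.
Proof.
move=> sp cc'; apply/colP => j.
have [l sl e] := sp (delta_mx 0 j).
have E (d : 'cV[F]_n) : d j 0 = (l *m (M *m d)) 0 0.
  by rewrite mulmxA -e -rowE mxE.
rewrite !E !mxE; apply: eq_bigr => i _.
by have [/cc' ->//|/sl ->] := boolP (i \in s); rewrite !mul0r.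
Qed.

Lemma ker_spans s :
  (forall c, (forall i, i \in s -> (M *m c) i 0 = 0) -> c = 0) -> spans M s.
Proof.
move=> ker; apply/spansP; rewrite /row_full eqn_leq rank_leq_col /=.
suff c0 : cokermx (subfamily s) = 0.
  by have := mxrank_coker (subfamily s); rewrite c0 mxrank0 => /esym/eqP.
apply/matrixP => i j; rewrite [RHS]mxE.
have := ker (col j (cokermx (subfamily s))) _.
move=> /(_ _)/(congr1 (fun c : 'cV__ => c i 0)); rewrite !mxE; apply => k sk.
rewrite -(enum_rankK_in sk sk) -subfamily_mul colE mulmxA mulmx_coker.
by rewrite mul0mx mxE.
Qed.

Lemma indepS s t : s \subset t -> indep M t -> indep M s.
Proof. by move=> st ind l /(supported_sub st)/ind. Qed.

Lemma indep_inj s l l' : indep M s -> supported s l -> supported s l' ->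
  l *m M = l' *m M -> l = l'.
Proof.
move=> ind sl sl' e; apply/eqP; rewrite -subr_eq0; apply/eqP.
by apply: ind; [exact: supportedB|rewrite mulmxBl e subrr].
Qed.

Lemma indep_add s i : indep M s ->
  ~ (exists2 l, supported s l & row i M = l *m M) -> indep M (i |: s).
Proof.
move=> ind nspan l sl l0.
have [li0|li0] := eqVneq (l 0 i) 0.
  apply: ind => // j sj; have [->//|ji] := eqVneq j i.
  by apply: sl; rewrite !inE negb_or ji.
case: nspan; exists (delta_mx 0 i - (l 0 i)^-1 *: l).
  move=> j sj; rewrite !mxE eqxx /=; have [->|ji] := eqVneq j i.
    by rewrite mulVf ?subrr.
  rewrite (_ : l 0 j = 0) ?mulr0 ?subrr //.
  by apply: sl; rewrite !inE negb_or ji.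
by rewrite mulmxBl -scalemxAl l0 scaler0 subr0 -rowE.
Qed.

Lemma rows_spans_sub s t : spans M t ->
  (forall i, exists2 l, supported s l & row i M = l *m M) -> spans M s.
Proof.
move=> spT rowt x; have [l _ ->] := spT x.
have {}rowt i : exists l', supported s l' /\ row i M = l' *m M.
  by have [l' ? ?] := rowt i; exists l'.
have [f fP] := choice rowt.
exists (\sum_i l 0 i *: f i).
  move=> j tj; rewrite summxE big1 // => i _.
  by rewrite mxE (fP i).1 // mulr0.
rewrite mulmx_sum_row mulmx_suml; apply: eq_bigr => i _.
by rewrite (fP i).2 -scalemxAl.
Qed.

(** An independent set that cannot be enlarged spans all the rows. *)
Lemma indep_extend s : spans M [set: 'I_m] -> indep M s ->
  exists t : {set 'I_m}, [/\ s \subset t, indep M t & spans M t].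
Proof.
move=> spT ind.
pose P (t : {set 'I_m}) := (s \subset t) && `[< indep M t >].
have Ps : P s by rewrite /P subxx; apply/asboolP.
have [t /maxsetP[/andP[st /asboolP it] tmax] _] := @maxset_exists _ P s Ps.
exists t; split => //.
have rowt i : exists2 l, supported t l & row i M = l *m M.
  apply: contrapT => ni; have ti : i \in t.
    rewrite -(tmax (i |: t)) ?finset.setU11 ?finset.subsetUr// /P.
    rewrite (fintype.subset_trans st) ?finset.subsetUr //=.
    exact/asboolP/indep_add.
  by case: ni; exists (delta_mx 0 i); [exact: supported_delta|rewrite -rowE].
exact: rows_spans_sub spT rowt.
Qed.

End IndexedRows.

(** * Conical hulls and Farkas' lemma *)

(** Moving from [f] in the direction [g], the first coordinate to reach zero
is the one with the least ratio. *)
Lemma ratio_test (F : realFieldType) (I : finType) (f g : I -> F) :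
  (forall i, 0 <= f i) -> (exists i, g i < 0) ->
  exists i0 t, [/\ g i0 < 0, 0 <= t, f i0 + t * g i0 = 0
    & forall i, 0 <= f i + t * g i].
Proof.
move=> f0 [i1 gi1].
case: (@arg_minP _ _ I i1 (fun i => g i < 0) (fun i => f i / - g i) gi1).
move=> i0 gi0 min0; have t0 : 0 <= f i0 / - g i0.
  by apply: divr_ge0 => //; rewrite oppr_ge0 ltW.
exists i0, (f i0 / - g i0); split => //.
  by rewrite invrN mulrN mulNr divfK ?subrr // lt_eqF.
move=> i; have [gi|gi] := ltP (g i) 0; last first.
  by apply: addr_ge0 => //; apply: mulr_ge0.
have := min0 i gi; rewrite ler_pdivlMr ?oppr_gt0 // mulrN lerNl => h.
by rewrite -lerBlDl sub0r.
Qed.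

(** The coefficients range over the ring of the entries of [M], so that this is
a convex cone over a field and a set of nonnegative integer combinations over
[int]. *)
Definition conic (F : realDomainType) (m n : nat) (M : 'M[F]_(m, n))
    (s : {set 'I_m}) (x : 'rV[F]_n) : Prop :=
  exists l : 'rV[F]_m,
    [/\ supported s l, forall i, 0 <= l 0 i & x = l *m M].

Lemma mulmx1E (F : realFieldType) m (l : 'rV[F]_m) (w : 'cV[F]_m) :
  (l *m w) 0 0 = \sum_i l 0 i * w i 0.
Proof. by rewrite mxE. Qed.

Lemma mulmx_le (F : realFieldType) m (l : 'rV[F]_m) (v w : 'cV[F]_m) :
  (forall i, 0 <= l 0 i) -> (forall i, v i 0 <= w i 0) ->
  (l *m v) 0 0 <= (l *m w) 0 0.
Proof.
by move=> l0 vw; rewrite !mulmx1E; apply: ler_sum => i _; apply: ler_wpM2l.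
Qed.

(** Complementary slackness: nonnegative terms with sum zero all vanish. *)
Lemma mulmx_le_slack (F : realFieldType) m (l : 'rV[F]_m) (v w : 'cV[F]_m) :
  (forall i, 0 <= l 0 i) -> (forall i, v i 0 <= w i 0) ->
  (l *m w) 0 0 <= (l *m v) 0 0 -> forall i, l 0 i = 0 \/ v i 0 = w i 0.
Proof.
move=> l0 vw; rewrite !mulmx1E -subr_ge0 -sumrB => le0 i.
have E : \sum_i (l 0 i * w i 0 - l 0 i * v i 0) = 0.
  apply/eqP; rewrite eq_le -oppr_ge0 -sumrN.
  under eq_bigr do rewrite opprB; rewrite le0 /=.
  by apply: sumr_ge0 => j _; rewrite -mulrBr mulr_ge0 ?subr_ge0.
have : l 0 i * w i 0 - l 0 i * v i 0 = 0.
  by apply: (psumr_eq0P _ E) => // j _; rewrite -mulrBr mulr_ge0 ?subr_ge0.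
move/eqP; rewrite -mulrBr mulf_eq0 subr_eq0 => /orP[] /eqP; first by left.
by right.
Qed.

Section ConicBasics.
Variables (F : realDomainType) (m n : nat) (M : 'M[F]_(m, n)).
Implicit Types s t : {set 'I_m}.

Lemma conicS s t x : s \subset t -> conic M s x -> conic M t x.
Proof. by move=> /supported_sub st [l [/st sl l0 ->]]; exists l. Qed.

Lemma conic0 s : conic M s 0.
Proof.
exists 0; split; [exact: supported0 | by move=> i; rewrite mxE |].
by rewrite mul0mx.
Qed.

Lemma conicD s x y : conic M s x -> conic M s y -> conic M s (x + y).
Proof.
move=> [l [sl l0 ->]] [l' [sl' l0' ->]]; exists (l + l'); split.
- exact: supportedD.
- by move=> i; rewrite mxE addr_ge0.
- by rewrite mulmxDl.
Qed.

Lemma conicZ s a x : 0 <= a -> conic M s x -> conic M s (a *: x).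
Proof.
move=> a0 [l [sl l0 ->]]; exists (a *: l); split.
- exact: supportedZ.
- by move=> i; rewrite mxE mulr_ge0.
- by rewrite scalemxAl.
Qed.

Lemma conic_row s i : i \in s -> conic M s (row i M).
Proof.
move=> si; exists (delta_mx 0 i); split; first exact: supported_delta.
  by move=> j; rewrite mxE; case: (_ && _).
by rewrite -rowE.
Qed.

Lemma conic_sum s (I : Type) (r : seq I) (P : pred I) (x : I -> 'rV[F]_n) :
  (forall i, P i -> conic M s (x i)) -> conic M s (\sum_(i <- r | P i) x i).
Proof.
by move=> cx; apply: big_ind => //; [exact: conic0|exact: conicD].
Qed.

Lemma conic_trans s t x :
  (forall i, i \in s -> conic M t (row i M)) -> conic M s x -> conic M t x.
Proof.
move=> st [l [sl l0 ->]]; rewrite mulmx_sum_row; apply: conic_sum => i _.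
have [/st|/sl ->] := boolP (i \in s); first exact: conicZ.
by rewrite scale0r; exact: conic0.
Qed.

End ConicBasics.

Section Conic.
Variables (F : realFieldType) (m n : nat) (M : 'M[F]_(m, n)).
Implicit Types (s t : {set 'I_m}) (l : 'rV[F]_m) (c : 'cV[F]_n).

Lemma conic_indep s l : indep M s -> supported s l -> conic M s (l *m M) ->
  forall i, 0 <= l 0 i.
Proof.
by move=> ind sl [l' [sl' l0' /(indep_inj ind sl sl') ->]].
Qed.

(** A nonnegative combination can be pushed along a linear dependence of its
generators until one coefficient vanishes, in the direction that does not raise
the linear objective [w]; feasibility of [M c <= w] keeps the objective from
decreasing for ever. *)
Lemma basic_conic (w : 'cV[F]_m) c : (forall i, (M *m c) i 0 <= w i 0) ->
  forall s l, supported s l -> (forall i, 0 <= l 0 i) ->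
  exists t l', [/\ t \subset s, indep M t, supported t l',
    forall i, 0 <= l' 0 i & l' *m M = l *m M /\ (l' *m w) 0 0 <= (l *m w) 0 0].
Proof.
move=> cw s; have [k] := ubnP #|s|; elim: k s => // k IH s sk l sl l0.
have [ind|nind] := pselect (indep M s); first by exists s, l; split.
have [nu [snu nuM nu0]] : exists nu, [/\ supported s nu, nu *m M = 0 & nu <> 0].
  apply: contrapT => h; apply: nind => nu snu nuM; apply: contrapT => nu0.
  by apply: h; exists nu.
have {nu0 snu nuM nu} [nu [snu nuM nu0 nuw]] : exists nu,
    [/\ supported s nu, nu *m M = 0, nu <> 0 & (nu *m w) 0 0 <= 0].
  have [nuw|/ltW nuw] := leP ((nu *m w) 0 0) 0; first by exists nu.
  exists (- nu); split.
  - by rewrite -scaleN1r; apply: supportedZ.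
  - by rewrite mulNmx nuM oppr0.
  - by move/eqP; rewrite oppr_eq0 => /eqP.
  - by rewrite mulNmx mxE oppr_le0.
have {nu0 snu nuM nuw nu} [nu [snu nuM nuw nu0]] : exists nu,
    [/\ supported s nu, nu *m M = 0, (nu *m w) 0 0 <= 0 & exists i, nu 0 i < 0].
  have [neg|nneg] := pselect (exists i, nu 0 i < 0); first by exists nu.
  have nuge i : 0 <= nu 0 i.
    by rewrite leNgt; apply/negP => ?; apply: nneg; exists i.
  exists (- nu); split.
  - by rewrite -scaleN1r; apply: supportedZ.
  - by rewrite mulNmx nuM oppr0.
  - rewrite mulNmx mxE oppr_le0; apply: le_trans (mulmx_le nuge cw).
    by rewrite mulmxA nuM mul0mx mxE.
  - apply: contrapT => npos; apply: nu0; apply/rowP => i; rewrite mxE.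
    apply/eqP; rewrite eq_le nuge andbT leNgt; apply/negP => ?; apply: npos.
    by exists i; rewrite mxE oppr_lt0.
have [i0 [t [nui t0 ti0 tge]]] := ratio_test l0 nu0.
have si0 : i0 \in s.
  by apply: contraLR nui => /snu ->; rewrite ltxx.
have [|||t' [l' [t's indt sl' l'0 [l'M l'w]]]] :=
  IH (s :\ i0)%SET _ (l + t *: nu) _ _.
- by move: sk; rewrite (cardsD1 i0 s) si0 add1n ltnS.
- move=> i; rewrite !finset.inE negb_and negbK mxE [X in _ + X]mxE.
  move=> /orP[/eqP ->|si] //.
  by rewrite sl // snu // mulr0 addr0.
- by move=> i; rewrite mxE [X in _ + X]mxE.
exists t', l'; split => //.
  exact: fintype.subset_trans t's (subD1set _ _).
split; first by rewrite l'M mulmxDl -scalemxAl nuM scaler0 addr0.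
apply: le_trans l'w _; rewrite mulmxDl -scalemxAl mxE [X in _ + X]mxE.
by rewrite gerDl mulr_ge0_le0.
Qed.

Lemma caratheodory s x : conic M s x ->
  exists t : {set 'I_m}, [/\ t \subset s, indep M t & conic M t x].
Proof.
move=> [l [sl l0 ->]]; have [|t [l' [ts ind sl' l0' [<- _]]]] :=
  @basic_conic 0 0 _ s l sl l0; first by move=> i; rewrite mulmx0.
by exists t; split => //; exists l'.
Qed.

End Conic.

(** Induction on the number of generators.  If the conclusion fails without the
generator [i], some [x0] witnesses it, and [a_i] is positive at [x0].  Subtract
from [y] and from the other generators the multiples of [a_i] that make them
vanish at [x0]: on the kernel of [a_i] nothing has changed, and the induction
hypothesis applies. *)
Lemma farkas (F : realFieldType) (m n : nat) (s : {set 'I_m})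
    (M : 'M[F]_(m, n)) (y : 'rV[F]_n) :
  (forall c : 'cV[F]_n, (forall i, i \in s -> (M *m c) i 0 <= 0) ->
    (y *m c) 0 0 <= 0) ->
  conic M s y.
Proof.
have [k] := ubnP #|s|; elim: k s M y => // k IH s M y sk hy.
have [s0|[i si]] := set_0Vmem s.
  have y0 (c : 'cV[F]_n) : (y *m c) 0 0 = 0.
    apply/eqP; rewrite eq_le hy; last by move=> i; rewrite s0 finset.inE.
    rewrite -oppr_le0; have -> : - (y *m c) 0 0 = (y *m - c) 0 0.
      by rewrite mulmxN [RHS]mxE.
    by apply: hy => i; rewrite s0 finset.inE.
  suff -> : y = 0 by exact: conic0.
  by apply/rowP => j; have := y0 (delta_mx j 0); rewrite -colE !mxE.
have ssi : (s :\ i)%SET \subset s := subD1set _ _.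
have ski : (#|(s :\ i)%SET| < k)%N.
  by move: sk; rewrite (cardsD1 i s) si add1n ltnS.
have [hy'|] := pselect (forall c : 'cV[F]_n,
    (forall j, j \in (s :\ i)%SET -> (M *m c) j 0 <= 0) -> (y *m c) 0 0 <= 0).
  exact: conicS ssi (IH _ _ _ ski hy').
move=> /existsNP[x /not_implyP[xs /negP]].
rewrite -ltNge => yx.
have xi : 0 < (M *m x) i 0.
  rewrite ltNge; apply/negP => xi; move: yx; rewrite ltNge hy // => j sj.
  by have [->//|ji] := eqVneq j i; apply: xs; rewrite !finset.inE ji.
(* Normalized so that [a_i] takes the value 1 at [x0]. *)
pose x0 := ((M *m x) i 0)^-1 *: x.
have Ex0 j : (M *m x0) j 0 = ((M *m x) i 0)^-1 * (M *m x) j 0.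
  by rewrite /x0 -scalemxAr mxE.
have x0s j : j \in (s :\ i)%SET -> (M *m x0) j 0 <= 0.
  by move=> sj; rewrite Ex0 pmulr_rle0 ?invr_gt0 ?xs.
have x0i : (M *m x0) i 0 = 1 by rewrite Ex0 mulVf // gt_eqF.
have yx0 : 0 < (y *m x0) 0 0.
  by rewrite -scalemxAr mxE mulr_gt0 ?invr_gt0.
have Erow (c : 'cV[F]_n) : (row i M *m c) 0 0 = (M *m c) i 0.
  by rewrite -row_mul mxE.
have [|l [sl l0 El]] := IH _ (M - (M *m x0) *m row i M)
  (y - (y *m x0) *m row i M) ski.
  move=> c hc; pose c' := c - (M *m c) i 0 *: x0.
  have E k' (u : 'M[F]_(k', n)) : (u - (u *m x0) *m row i M) *m c = u *m c'.
    rewrite /c' mulmxBl mulmxBr -(mulmxA (u *m x0)) [row i M *m c]mx11_scalar.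
    by rewrite Erow mul_mx_scalar scalemxAr.
  rewrite E; apply: hy => j sj; have [->|ji] := eqVneq j i.
    rewrite mulmxBr mxE [X in _ + X]mxE -scalemxAr [X in - X]mxE.
    by rewrite x0i mulr1 subrr.
  by rewrite -E hc // !finset.inE ji.
pose a := (y *m x0) 0 0 - (l *m (M *m x0)) 0 0.
have -> : y = l *m M + a *: row i M.
  have := congr1 (fun u => u + (y *m x0) *m row i M) El; rewrite subrK => ->.
  rewrite mulmxBr -addrA; congr (_ + _).
  rewrite [y *m x0]mx11_scalar [X in - X]mulmxA [l *m (M *m x0)]mx11_scalar.
  by rewrite !mul_scalar_mx -scaleNr -scalerDl addrC.
apply: conicD; first by apply: (conicS ssi); exists l.
apply: conicZ; last exact: conic_row.
rewrite subr_ge0; apply: le_trans (ltW yx0).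
rewrite mulmx1E; apply: sumr_le0 => j _.
have [/x0s h|/sl ->] := boolP (j \in (s :\ i)%SET); last by rewrite mul0r.
by rewrite mulr_ge0_le0.
Qed.

(** Farkas' lemma applied to the homogenized system [V c <= t v, t >= 0]. *)
Lemma affine_farkas (F : realFieldType) (k n : nat) (V : 'M[F]_(k, n))
    (v : 'cV[F]_k) :
  ~ (exists c : 'cV[F]_n, forall i, (V *m c) i 0 <= v i 0) ->
  exists l : 'rV[F]_k,
    [/\ forall i, 0 <= l 0 i, l *m V = 0 & (l *m v) 0 0 < 0].
Proof.
move=> infeasible.
pose W := col_mx (row_mx V (- v)) (row_mx 0 (- 1%:M)) : 'M[F]_(k + 1, n + 1).
have [|l [_ l0 El]] := @farkas F _ _ [set: 'I_(k + 1)] W (row_mx 0 1%:M).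
  move=> c; rewrite -[c]vsubmxK => hc.
  set d := usubmx c in hc *; set t := dsubmx c in hc *.
  rewrite mul_row_col mul0mx add0r mul1mx leNgt; apply/negP => t0.
  apply: infeasible; exists ((t 0 0)^-1 *: d) => i.
  have h : (V *m d) i 0 <= t 0 0 * v i 0.
    have := hc (lshift 1 i) (finset.in_setT _).
    set a := t 0 0.
    rewrite mul_col_mx col_mxEu mul_row_col mxE mulNmx [t]mx11_scalar -/a.
    by rewrite mul_mx_scalar [X in _ + X]mxE [X in - X]mxE subr_le0.
  by rewrite -scalemxAr mxE ler_pdivrMl.
move: El; rewrite -[l]hsubmxK mul_row_col !mul_mx_row mulmx0.
rewrite add_row_mx addr0 mulmxN mulmxN mulmx1 => /eq_row_mx[El1 El2].
exists (lsubmx l); split => //; first by move=> i; rewrite mxE.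
have := congr1 (fun u : 'M__ => u 0 0) El2; rewrite !mxE eqxx /=.
have := l0 (rshift k 0); rewrite -mulmx1E; lra.
Qed.

(** * Cells of a weight vector and their perturbation *)

(** The functional [c] exposes the rows of [t] below the weights [w]; the cells
of a generic [w] are the simplices of a regular triangulation. *)
Definition cell (F : realFieldType) (m n : nat) (M : 'M[F]_(m, n))
    (w : 'cV[F]_m) (t : {set 'I_m}) : Prop :=
  exists c : 'cV[F]_n, (forall i, i \in t -> (M *m c) i 0 = w i 0) /\
    (forall i, i \notin t -> (M *m c) i 0 < w i 0).

Section Cells.
Variables (F : realFieldType) (m n : nat) (M : 'M[F]_(m, n)) (w : 'cV[F]_m).
Implicit Types (s t : {set 'I_m}) (l : 'rV[F]_m) (c : 'cV[F]_n).

(** Linear programming duality.  Among the finitely many representations of [x]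
over independent sets one has the least weight [a]; by Farkas' lemma a feasible
[c] attains [a] at [x], and complementary slackness confines that
representation to the rows that are tight at [c]. *)
Lemma conic_cover c0 : (forall i, (M *m c0) i 0 <= w i 0) ->
  forall x, conic M [set: 'I_m] x -> exists2 t, cell M w t & conic M t x.
Proof.
move=> c0w x cx.
have /choice[f fP] : forall t, exists l, conic M t x ->
    [/\ supported t l, forall i, 0 <= l 0 i & x = l *m M].
  move=> t; have [[l lP]|nc] := pselect (conic M t x); first by exists l.
  by exists 0.
pose P t := `[< indep M t /\ conic M t x >].
have [t1 [_ it1 ct1]] := caratheodory cx.
have Pt1 : P t1 by apply/asboolP.
case: (@arg_minP _ _ _ t1 P (fun t => (f t *m w) 0 0) Pt1).
move=> t /asboolP[it /fP[st f0 xt]] tmin; pose a := (f t *m w) 0 0.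
have [c [cw ca]] : exists c, (forall i, (M *m c) i 0 <= w i 0) /\
    a <= (x *m c) 0 0.
  apply: contrapT => nc.
  have [|l [l0 lM lw]] := @affine_farkas F (m + 1) n (col_mx M (- x))
    (col_mx w (- a%:M)).
    move=> [c hc]; apply: nc; exists c; split=> [i|].
      by have := hc (lshift 1 i); rewrite mul_col_mx !col_mxEu.
    have := hc (rshift m 0); rewrite mul_col_mx !col_mxEd mulNmx.
    by rewrite [X in X <= _]mxE [X in _ <= X]mxE [a%:M _ _]mxE mulr1n lerN2.
  move: lM lw l0; rewrite -[l]hsubmxK; set l1 := lsubmx l; set u := rsubmx l.
  rewrite !mul_row_col !mulmxN => /eqP; rewrite subr_eq0 => /eqP.
  rewrite [u]mx11_scalar; set b := u 0 0 => lM lw l0.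
  have l10 i : 0 <= l1 0 i by have := l0 (lshift 1 i); rewrite row_mxEl.
  have b0 : 0 <= b.
    by have := l0 (rshift m 0); rewrite row_mxEr mxE mulr1n.
  move: lM lw; rewrite -scalar_mxM mul_scalar_mx mxE [X in _ + X]mxE.
  rewrite [(b * a)%:M _ _]mxE mulr1n subr_lt0 => lM lw.
  move: b0; rewrite le_eqVlt => /orP[/eqP b0|b0].
    move: lw; rewrite -b0 mul0r ltNge => /negP; apply.
    apply: le_trans (mulmx_le l10 c0w).
    by rewrite mulmxA lM -b0 scale0r mul0mx mxE.
  have l2M : (b^-1 *: l1) *m M = x.
    by rewrite -scalemxAl lM scalerA mulVf ?gt_eqF // scale1r.
  have l20 i : 0 <= (b^-1 *: l1) 0 i by rewrite mxE mulr_ge0 // invr_ge0 ltW.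
  have [t' [l' [_ it' sl' l'0 [l'M l'w]]]] :=
    basic_conic c0w (@supportedT _ _ _) l20.
  have ct' : conic M t' x by exists l'; split => //; rewrite l'M.
  have := tmin t' (introT (asboolP _) (conj it' ct')).
  have [sft' _ xt'] := fP _ ct'.
  have -> : f t' = l' by apply: (indep_inj it' sft' sl'); rewrite -xt' l'M l2M.
  rewrite leNgt => /negP; apply; apply: le_lt_trans l'w _.
  by rewrite -scalemxAl mxE mulrC ltr_pdivrMr // mulrC.
have slack := mulmx_le_slack f0 cw.
exists [set i | (M *m c) i 0 == w i 0]%SET.
  exists c; split=> i; rewrite finset.inE; first by move/eqP.
  by rewrite lt_neqAle cw andbT.
exists (f t); split => // i; rewrite finset.inE => ni.
have [|//|e] := slack _ i; first by rewrite mulmxA -xt.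
by rewrite e eqxx in ni.
Qed.

Lemma cell_le t c : (forall i, i \in t -> (M *m c) i 0 = w i 0) ->
  (forall i, i \notin t -> (M *m c) i 0 < w i 0) ->
  forall i, (M *m c) i 0 <= w i 0.
Proof.
by move=> ct cn i; have [/ct ->|/cn/ltW] := boolP (i \in t).
Qed.

(** A functional [c] that exposes one cell takes the least possible weight at
every point of its cone, so that a representation over the other cell can only
use generators that are tight at [c]. *)
Lemma cell_conicI s t x : cell M w s -> cell M w t ->
  conic M s x -> conic M t x -> conic M (s :&: t) x.
Proof.
move=> [c [cs cn]] [d [dt dn]] [l [sl l0 xl]] [l' [sl' l'0 xl']].
have value u (lu : 'rV[F]_m) (e : 'cV[F]_n) : supported u lu ->
    (forall i, i \in u -> (M *m e) i 0 = w i 0) ->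
    (lu *m w) 0 0 = (lu *m (M *m e)) 0 0.
  move=> su eu; rewrite !mulmx1E; apply: eq_bigr => i _.
  by have [/eu ->//|/su ->] := boolP (i \in u); rewrite !mul0r.
have slack := mulmx_le_slack l'0 (cell_le cs cn).
exists l'; split => // i; rewrite finset.inE negb_and.
move=> /orP[si|]; last exact: sl'.
have [|//|e] := slack _ i; last by have := cn i si; rewrite e ltxx.
rewrite (value _ _ _ sl' dt) !mulmxA -xl' xl -!mulmxA -(value _ _ _ sl cs).
exact: mulmx_le (cell_le dt dn).
Qed.

End Cells.

Lemma near0_lt (R : realType) (a b u v : R) : a < b ->
  \forall e \near 0^'+, a + e * u < b + e * v.
Proof.
move=> ab; have k0 : 0 < `|u - v| + 1 by apply: ltr_wpDl.
have h : 0 < (b - a) / (`|u - v| + 1) by rewrite divr_gt0 ?subr_gt0.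
near=> e.
have e0 : 0 < e by near: e; exact: nbhs_right_gt.
have : e < (b - a) / (`|u - v| + 1) by near: e; exact: nbhs_right_lt.
rewrite ltr_pdivlMr // => eh.
have : e * (u - v) <= e * (`|u - v| + 1).
  by rewrite ler_pM2l //; apply: le_trans (ler_norm _) _; rewrite lerDl.
by rewrite mulrBr; lra.
Unshelve. all: by end_near. Qed.

Section Perturbation.
Variables (R : realType) (m n : nat) (M : 'M[R]_(m, n)).
Implicit Types (s t : {set 'I_m}) (w d : 'cV[R]_m) (c : 'cV[R]_n).

(** Tilting [c] slightly releases exactly the rows of [s] outside [t]. *)
Lemma cell_sub w s t : indep M s -> t \subset s -> cell M w s -> cell M w t.
Proof.
move=> ind ts [c [cs cn]].
have [d dP] := indep_lift (fun i => - (i \notin t)%:R) ind.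
have : \forall e \near 0^'+, forall i, i \notin s ->
    (M *m c) i 0 + e * (M *m d) i 0 < w i 0 + e * 0.
  apply: filter_forall => i; have [si|si] := boolP (i \in s).
    by near=> e.
  by near=> e => _; near: e; apply: near0_lt; exact: cn.
move=> near_e; near (0 : R)^'+ => e.
have e0 : 0 < e by near: e; exact: nbhs_right_gt.
exists (c + e *: d).
split=> i it; rewrite mulmxDr -scalemxAr mxE [X in _ + X]mxE.
  have si := fintype.subsetP ts i it.
  by rewrite dP // it oppr0 mulr0 addr0 cs.
have [si|si] := boolP (i \in s).
  by rewrite dP // it cs // mulrN1 gtrDl oppr_lt0.
rewrite -[ltRHS]addr0 -(mulr0 e); move: i si {it}; near: e; exact: near_e.
Unshelve. all: by end_near. Qed.

Lemma cell_open t w d : indep M t -> cell M w t ->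
  \forall e \near 0^'+, cell M (w + e *: d) t.
Proof.
move=> ind [c [ct cn]]; have [c' c'P] := indep_lift (fun i => d i 0) ind.
have : \forall e \near 0^'+, forall i, i \notin t ->
    (M *m c) i 0 + e * (M *m c') i 0 < w i 0 + e * d i 0.
  apply: filter_forall => i; have [ti|ti] := boolP (i \in t).
    by near=> e.
  by near=> e => _; near: e; apply: near0_lt; exact: cn.
apply: filterS => e he; exists (c + e *: c').
have E i : (M *m (c + e *: c')) i 0 = (M *m c) i 0 + e * (M *m c') i 0.
  by rewrite mulmxDr -scalemxAr mxE [X in _ + X]mxE.
have E' i : (w + e *: d) i 0 = w i 0 + e * d i 0 by rewrite !mxE.
split=> i it; rewrite E E'; first by rewrite ct // c'P.
exact: he.
Unshelve. all: by end_near. Qed.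

(** Finitely many hyperplanes can be left one at a time by steps so small that
the condition [C] survives, as do the earlier non-vanishings. *)
Lemma generic_weights (C : set 'cV[R]_m) (L : seq 'rV[R]_m) w0 :
  (forall w d, C w -> \forall e \near 0^'+, C (w + e *: d)) ->
  (forall v, v \in L -> v != 0) -> C w0 ->
  exists2 w, C w & forall v, v \in L -> (v *m w) 0 0 != 0.
Proof.
move=> Copen L0 C0; elim: L L0 => [_|v L IH L0]; first by exists w0.
have [|w Cw wL] := IH; first by move=> v' vL; rewrite L0 // in_cons vL orbT.
have [vw|vw] := eqVneq ((v *m w) 0 0) 0; last first.
  by exists w => // v'; rewrite in_cons => /orP[/eqP ->|/wL].
have [i vi] : exists i, v 0 i != 0.
  apply: contrapT => h; have /eqP := L0 v (mem_head _ _); apply.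
  apply/rowP => i; rewrite mxE; apply: contrapT => vi; apply: h.
  by exists i; apply/eqP.
pose d : 'cV[R]_m := delta_mx i 0.
have E (v' : 'rV[R]_m) e :
    (v' *m (w + e *: d)) 0 0 = (v' *m w) 0 0 + e * v' 0 i.
  by rewrite mulmxDr -scalemxAr -colE mxE [X in _ + X]mxE [X in _ * X]mxE.
have nearL : \forall e \near 0^'+, forall v', v' \in L ->
    (v' *m (w + e *: d)) 0 0 != 0.
  have : \forall e \near 0^'+, forall k : 'I_(size L),
      (L`_k *m (w + e *: d)) 0 0 != 0.
    apply: filter_forall => k; have := wL _ (mem_nth 0 (ltn_ord k)).
    rewrite neq_lt => /orP[h|h].
      have := near0_lt (L`_k 0 i) 0 h; apply: filterS => e.
      by rewrite mulr0 addr0 E neq_lt => ->.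
    have := near0_lt 0 (L`_k 0 i) h; apply: filterS => e.
    by rewrite mulr0 addr0 E neq_lt orbC => ->.
  apply: filterS => e he v' /(nthP 0)[k kL <-]; exact: (he (Ordinal kL)).
near (0 : R)^'+ => e.
have e0 : 0 < e by near: e; exact: nbhs_right_gt.
exists (w + e *: d); first by near: e; exact: Copen.
move=> v'; rewrite in_cons => /orP[/eqP ->|].
  by rewrite E vw add0r mulf_neq0 // gt_eqF.
by move: v'; near: e.
Unshelve. all: by end_near. Qed.

End Perturbation.

(** * Primitive configurations and empty basis cones *)

Lemma toR_inj (R : realType) (m n : nat) : injective (@toR R m n).
Proof.
move=> M N /matrixP e; apply/matrixP => i j.
by have := e i j; rewrite !mxE => /intr_inj.
Qed.

Lemma toRM (R : realType) (m n p : nat) (M : 'M[int]_(m, n))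
    (N : 'M[int]_(n, p)) :
  toR R (M *m N) = toR R M *m toR R N.
Proof. exact: map_mxM. Qed.

Lemma row_toR (R : realType) (m n : nat) (M : 'M[int]_(m, n)) i :
  row i (toR R M) = toR R (row i M).
Proof. by rewrite /toR map_row. Qed.

Lemma supported_toR (R : realType) (m : nat) s (l : 'rV[int]_m) :
  supported s l -> supported s (toR R l).
Proof. by move=> sl i si; rewrite mxE sl. Qed.

Lemma primitive_bezout (n : nat) (a : 'rV[int]_n) : primitive_vec a ->
  exists p : 'cV[int]_n, (a *m p) 0 0 = 1.
Proof.
rewrite /primitive_vec => a1.
suff [p pE] : exists p : 'cV[int]_n,
    (a *m p) 0 0 = (\big[gcdn/0%N]_(j < n) absz (a 0 j))%:Z.
  by exists p; rewrite pE a1.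
elim/big_ind: _ => [|x y [p px] [q qy]|j _].
- by exists 0; rewrite mulmx0 mxE.
- have [u [v uv]] := Bezoutz x%:Z y%:Z.
  exists (u *: p + v *: q).
  by rewrite mulmxDr -!scalemxAr mxE [X in X + _]mxE [X in _ + X]mxE px qy uv.
- exists (Num.sg (a 0 j) *: delta_mx j 0).
  by rewrite -scalemxAr -colE !mxE abszE normrEsg mulrC.
Qed.

(** Pairing with Bezout vectors of [a] and [b] shows that the ratio and its
inverse are both integers. *)
Lemma primitive_parallel (R : realType) (n : nat) (a b : 'rV[int]_n) (r : R) :
  primitive_vec a -> primitive_vec b -> 0 <= r -> toR R b = r *: toR R a ->
  r = 1 /\ b = a.
Proof.
move=> /primitive_bezout[p ap] /primitive_bezout[q bq] r0 ba.
have pairing (c : 'cV[int]_n) : ((b *m c) 0 0)%:~R = r * ((a *m c) 0 0)%:~R.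
  have := congr1 (fun x => (x *m toR R c) 0 0) ba.
  by rewrite -scalemxAl -!toRM [X in _ = X -> _]mxE !mxE.
have rp : r = ((b *m p) 0 0)%:~R by rewrite pairing ap mulr1.
have r1 : r = 1.
  have := pairing q; rewrite bq rp -intrM => /(@intr_inj R)/esym.
  move: r0; rewrite rp ler0z; case: ((b *m p) 0 0) => // k _ e.
  have /eqP := congr1 absz e.
  by rewrite abszM /= muln_eq1 => /andP[/eqP -> _].
by split=> //; apply: (@toR_inj R); rewrite ba r1 scale1r.
Qed.

(** The squared length of [b x - a y] is positive. *)
Lemma strict_cauchy (R : realType) (n : nat) (x y : 'rV[R]_n) (a b : R) :
  0 < a -> 0 < b -> (x *m x^T) 0 0 = a ^+ 2 -> (y *m y^T) 0 0 = b ^+ 2 ->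
  b *: x != a *: y -> (x *m y^T) 0 0 < a * b.
Proof.
move=> a0 b0 xx yy; rewrite -subr_eq0 => xy.
pose v := b *: x - a *: y.
have v0 : 0 < (v *m v^T) 0 0.
  rewrite mxE; have [j vj] : exists j, v 0 j != 0.
    apply: contrapT => h; move/eqP: xy; apply; apply/rowP => j.
    by rewrite [RHS]mxE; apply: contrapT => /eqP vj; apply: h; exists j.
  rewrite (bigD1 j) //= ltr_wpDr //; last first.
    by rewrite [X in _ * X]mxE -expr2 exprn_even_gt0.
  by apply: sumr_ge0 => k _; rewrite [X in _ * X]mxE -expr2 sqr_ge0.
have yx : (y *m x^T) 0 0 = (x *m y^T) 0 0.
  by rewrite !mxE; apply: eq_bigr => k _; rewrite !mxE mulrC.
have E : (v *m v^T) 0 0 = 2 * (a * b) * (a * b - (x *m y^T) 0 0).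
  have -> : v^T = b *: x^T - a *: y^T by apply/matrixP => i j; rewrite !mxE.
  rewrite mulmxBl !mulmxBr -!scalemxAl -!scalemxAr.
  have D (M N : 'M[R]_1) : (M - N) 0 0 = M 0 0 - N 0 0 by rewrite !mxE.
  have Z c (M : 'M[R]_1) : (c *: M) 0 0 = c * M 0 0 by rewrite !mxE.
  by rewrite !(D, Z) xx yy yx; ring.
by move: v0; rewrite E pmulr_rgt0 ?subr_gt0 // !mulr_gt0.
Qed.

Section Configuration.
Variables (R : realType) (m n : nat) (A : 'M[int]_(m, n)).
Hypothesis A_inj : injective (fun i : 'I_m => row i A).
Hypothesis A_prim : forall i : 'I_m, primitive_vec (row i A).
Local Notation AR := (toR R A).
Implicit Types s t : {set 'I_m}.

Definition members s : {set 'I_m} :=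
  [set i | `[< conic AR s (row i AR) >]]%SET.

(** The first cone is real, the second one consists of integer combinations, so
this is the Hilbert basis property of the members. *)
Definition hilbert_members s : Prop := forall z : 'rV[int]_n,
  conic AR s (toR R z) -> conic A (members s) z.

Definition spans_lattice s : Prop := forall z : 'rV[int]_n,
  exists2 c : 'rV[int]_m, supported s c & z = c *m A.

Lemma in_members s i : reflect (conic AR s (row i AR)) (i \in members s).
Proof. by rewrite finset.inE; exact: asboolP. Qed.

Lemma sub_members s : s \subset members s.
Proof. by apply/fintype.subsetP => i si; apply/in_members/conic_row. Qed.

Lemma row_bezout i : exists p : 'cV[int]_n, (A *m p) i 0 = 1.
Proof.
have [p pE] := primitive_bezout (A_prim i); exists p.
by rewrite -[RHS]pE -row_mul [RHS]mxE.
Qed.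

Lemma row_neq0 i : row i AR != 0.
Proof.
have [p Ap] := row_bezout i; apply/eqP => r0.
have : (AR *m toR R p) i 0 = 0.
  have := congr1 (fun x => (x *m toR R p) 0 0) r0.
  by rewrite -row_mul mxE mul0mx => ->; rewrite mxE.
by rewrite -toRM mxE Ap => /eqP; rewrite oner_eq0.
Qed.

Lemma row_parallel i k (r : R) : 0 <= r -> row k AR = r *: row i AR -> k = i.
Proof.
rewrite !row_toR => r0 e; apply: A_inj.
exact: (primitive_parallel (A_prim i) (A_prim k) r0 e).2.
Qed.

Lemma indep1 i : indep AR [set i].
Proof.
move=> l sl; have -> : l = l 0 i *: delta_mx 0 i.
  apply/rowP => j; rewrite !mxE eqxx /=; have [->|ji] := eqVneq j i.
    by rewrite mulr1.
  by rewrite mulr0 sl // finset.inE.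
rewrite -scalemxAl -rowE => /eqP; rewrite scaler_eq0 (negPf (row_neq0 i)) orbF.
by move=> /eqP ->; rewrite scale0r.
Qed.

Lemma spans_lattice_hilbert s :
  indep AR s -> spans_lattice s -> hilbert_members s.
Proof.
move=> ind la z cz; apply: (conicS (sub_members s)).
have [c sc zc] := la z; exists c; split => // i.
have := conic_indep ind (@supported_toR R _ _ _ sc).
by rewrite -toRM -zc => /(_ cz i); rewrite mxE ler0z.
Qed.

(** Adding large multiples of the generators moves any lattice point into the
cone. *)
Lemma hilbert_spans_lattice s : spans AR s ->
  (forall z, conic AR s (toR R z) -> conic A s z) -> spans_lattice s.
Proof.
move=> sp hs z; have [l sl zl] := sp (toR R z).
pose k : 'rV[int]_m := \row_i if i \in s then `|Num.floor (l 0 i)| else 0.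
have sk : supported s k by move=> i /negPf si; rewrite mxE si.
have [|c [sc _ zc]] := hs (z + k *m A).
  exists (l + toR R k); split.
  - by apply: supportedD => //; exact: supported_toR.
  - move=> i; have [si|si] := boolP (i \in s); last first.
      by rewrite mxE [X in _ + X]mxE sl // sk // addr0.
    rewrite !mxE si -[leLHS](subrr (l 0 i)) lerD2l.
    have := floor_le (l 0 i); set f := Num.floor _ => fl.
    have : (- `|f|)%:~R <= f%:~R :> R.
      by rewrite ler_int lerNl ler_normr lexx orbT.
    by rewrite rmorphN /=; lra.
  - by rewrite mulmxDl -zl -toRM /toR map_mxD.
exists (c - k); first exact: supportedB.
by rewrite mulmxBl -zc addrK.
Qed.

Lemma empty_spans_lattice s :
  spans AR s -> members s \subset s -> hilbert_members s -> spans_lattice s.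
Proof.
move=> sp ms hs; apply: hilbert_spans_lattice => // z cz.
exact: conicS ms (hs z cz).
Qed.

(** If a vector of the configuration lies in the cone of [s] without generating
one of its rays, starring at it replaces [cone s] by smaller basis cones; so
only the cones that contain no further vector matter. *)
Lemma stellar_hilbert :
  (forall s, indep AR s -> spans AR s -> members s \subset s ->
    hilbert_members s) ->
  forall s, indep AR s -> spans AR s -> hilbert_members s.
Proof.
move=> empty s; have [k] := ubnP #|members s|; elim: k s => // k IH s sk ind sp.
have [|/subsetPn[i mi si]] := boolP (members s \subset s); first exact: empty.
move=> z [l [sl l0 zl]]; have [a [sa a0 ia]] := in_members _ _ mi.
have [||j0 [t [aj t0 tj tge]]] :=
    @ratio_test _ _ (fun i => l 0 i) (fun i => - a 0 i).
- exact: l0.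
- apply: contrapT => h; have /eqP := row_neq0 i; apply; rewrite ia.
  suff -> : a = 0 by rewrite mul0mx.
  apply/rowP => j; rewrite mxE; apply/eqP; rewrite eq_le a0 andbT leNgt.
  by apply/negP => aj; apply: h; exists j; rewrite oppr_lt0.
(* The vector [a_i] takes the place of [a_j0]. *)
have {}aj : a 0 j0 != 0 by apply: contraTneq aj => ->; rewrite oppr0 ltxx.
have sj0 : j0 \in s by apply: contraNT aj => /sa ->.
pose s' := (i |: s :\ j0)%SET.
have ssj : (s :\ j0)%SET \subset s := subD1set _ _.
have ind' : indep AR s'.
  apply: indep_add; first exact: indepS ind.
  move=> [b sb]; rewrite ia => /(indep_inj ind sa (supported_sub ssj sb)) ab.
  by move: aj; rewrite ab sb ?eqxx // !finset.inE eqxx.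
have s's : conic AR s' `<=` conic AR s.
  move=> x; apply: conic_trans => j.
  rewrite !finset.inE => /orP[/eqP ->|/andP[_]].
    exact/in_members.
  exact: conic_row.
have mem' : members s' \proper members s.
  apply/properP; split.
    apply/fintype.subsetP => j /in_members/s's; by move/in_members.
  exists j0; first exact: (fintype.subsetP (sub_members s)).
  apply/negP => /in_members[b [sb b0 jb]].
  pose b' := b - b 0 i *: delta_mx 0 i.
  have b'E j : b' 0 j = if j == i then 0 else b 0 j.
    rewrite !mxE eqxx /=; case: eqP => [->|_]; first by rewrite mulr1 subrr.
    by rewrite mulr0 subr0.
  have sb' : supported s b'.
    move=> j sj; rewrite b'E; case: eqP => // /eqP ji; apply: sb.
    by rewrite !finset.inE (negPf ji) (negPf sj) andbF.
  have b'j0 : b' 0 j0 = 0.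
    rewrite b'E; case: eqP => // /eqP ji; apply: sb.
    by rewrite !finset.inE (negPf ji) eqxx.
  have E : delta_mx 0 j0 = b' + b 0 i *: a.
    apply: (indep_inj ind).
    - exact: supported_delta.
    - by apply: supportedD => //; apply: supportedZ.
    - rewrite -rowE mulmxDl -scalemxAl -ia mulmxBl -scalemxAl -rowE subrK.
      exact: jb.
  have coord j : b' 0 j + b 0 i * a 0 j = (j == j0)%:R.
    by have := congr1 (fun x : 'rV__ => x 0 j) E; rewrite !mxE eqxx /= => ->.
  have bi : b 0 i != 0.
    apply/eqP => bi; have := coord j0.
    by rewrite bi mul0r b'j0 addr0 eqxx => /esym/eqP; rewrite oner_eq0.
  have aE : a = a 0 j0 *: delta_mx 0 j0.
    apply/rowP => j; rewrite !mxE eqxx /=; have [->|jj0] := eqVneq j j0.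
      by rewrite mulr1.
    have := coord j; rewrite (negPf jj0) mulr0 => /eqP.
    have b'0 : 0 <= b' 0 j by rewrite b'E; case: eqP.
    rewrite paddr_eq0 ?mulr_ge0 // => /andP[_].
    by rewrite mulf_eq0 (negPf bi) => /eqP.
  have /row_parallel : row i AR = a 0 j0 *: row j0 AR.
    by rewrite ia {1}aE -scalemxAl -rowE.
  by move=> /(_ (a0 j0)) e; rewrite e sj0 in si.
have sp' : spans AR s'.
  apply/(indep_spans ind'); rewrite cardsU1 !finset.inE (negPf si) andbF /=.
  by have := cardsD1 j0 s; rewrite sj0 => <-; apply/(indep_spans ind).
apply: (conicS (proper_sub mem')); apply: IH => //.
  exact: leq_trans (proper_card mem') _.
have -> : toR R z = (l - t *: a) *m AR + t *: row i AR.
  by rewrite zl ia mulmxBl -scalemxAl subrK.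
apply: conicD; last first.
  by apply: conicZ => //; apply: conic_row; rewrite !finset.inE eqxx.
exists (l - t *: a); split => //.
  move=> j; rewrite !finset.inE !negb_or negb_and negbK.
  move=> /andP[_ /orP[/eqP ->|sj]]; first by rewrite !mxE -mulrN.
  by rewrite !mxE sl // sa // mulr0 subrr.
by move=> j; rewrite !mxE -mulrN.
Qed.

(** The weights are [e |a_k| + g(a_k)] with [e] small, where [g] is the
piecewise linear function that sums the negative parts of the coordinates with
respect to [s].  Euclidean length is strictly convex off rays, so a supporting
functional at [a_i] exposes the ray of [a_i]; and [g] vanishes on [cone s]
only, so [s] is exposed once [e] is small. *)
Lemma empty_basis_weights s :
  indep AR s -> spans AR s -> members s \subset s ->
  exists w : 'cV[R]_m, cell AR w s /\ forall i, cell AR w [set i].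
Proof.
move=> ind sp ms.
(* The basis dual to [s]. *)
have /choice[y yP] : forall j, exists y : 'cV[R]_n,
    forall i, i \in s -> (AR *m y) i 0 = (i == j)%:R.
  by move=> j; exact: indep_lift.
have coord k : exists2 l : 'rV[R]_m, supported s l & row k AR = l *m AR /\
    forall j, j \in s -> (AR *m y j) k 0 = l 0 j.
  have [l sl kl] := sp (row k AR); exists l => //; split=> // j sj.
  have -> : (AR *m y j) k 0 = (row k AR *m y j) 0 0.
    by rewrite -row_mul [RHS]mxE.
  rewrite kl -mulmxA mulmx1E (bigD1 j) //= yP // eqxx mulr1.
  rewrite big1 ?addr0 // => i ij; have [/yP ->|/sl ->] := boolP (i \in s).
    by rewrite (negPf ij) mulr0.
  by rewrite mul0r.
pose g k := \sum_(j in s) Num.max 0 (- (AR *m y j) k 0).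
have g0 k : k \in s -> g k = 0.
  move=> sk; apply: big1 => j sj; rewrite yP //.
  by apply/max_idPl; rewrite oppr_le0.
have ggt0 k : k \notin s -> 0 < g k.
  move=> sk; rewrite lt_neqAle eq_sym sumr_ge0 ?andbT; last first.
    by move=> j _; rewrite le_max lexx.
  apply/negP => /eqP gk; move/negP: sk; apply; apply: (fintype.subsetP ms).
  have [l sl [kl lE]] := coord k; apply/in_members; exists l; split => // j.
  have [sj|/sl ->//] := boolP (j \in s).
  have := psumr_eq0P (F := fun j => Num.max 0 (- (AR *m y j) k 0)) _ gk.
  move=> /(_ _ j sj) h; rewrite -lE // -oppr_le0 -[leRHS]h.
    by rewrite le_max lexx orbT.
  by move=> i _; rewrite le_max lexx.
pose u k := Num.sqrt ((row k AR *m (row k AR)^T) 0 0).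
have usq k : (row k AR *m (row k AR)^T) 0 0 = u k ^+ 2.
  rewrite sqr_sqrtr // mxE; apply: sumr_ge0 => j _.
  by rewrite [X in _ * X]mxE -expr2 sqr_ge0.
have u0 k : 0 < u k.
  rewrite lt_neqAle sqrtr_ge0 andbT eq_sym; apply/eqP => uk.
  have /eqP := row_neq0 k; apply; have := usq k; rewrite uk expr0n /= mxE => e.
  apply/rowP => j; rewrite [RHS]mxE; apply/eqP; rewrite -sqrf_eq0; apply/eqP.
  have := psumr_eq0P _ e => /(_ _ j isT); rewrite [X in _ * X = _]mxE -expr2.
  by apply => i _; rewrite [X in _ * X]mxE -expr2 sqr_ge0.
have uu i k : k != i -> (row k AR *m (row i AR)^T) 0 0 < u k * u i.
  move=> ki; apply: strict_cauchy => //; apply: contraNneq ki => e.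
  have /row_parallel -> // : row k AR = (u k / u i) *: row i AR.
    by rewrite mulrC -scalerA -e scalerA mulVf ?scale1r // gt_eqF.
  by rewrite divr_ge0 // ltW.
have [cu cuP] := indep_lift u ind.
have nears : \forall e \near 0^'+, forall k, k \notin s ->
    0 + e * (AR *m cu) k 0 < g k + e * u k.
  apply: filter_forall => k; have [sk|sk] := boolP (k \in s).
    by near=> e.
  by near=> e => _; near: e; apply: near0_lt; exact: ggt0.
near (0 : R)^'+ => e.
have e0 : 0 < e by near: e; exact: nbhs_right_gt.
pose w : 'cV[R]_m := \col_k (g k + e * u k).
have wE k : w k 0 = g k + e * u k by rewrite mxE.
exists w; split.
  exists (e *: cu); split=> k sk; rewrite -scalemxAr mxE wE.
    by rewrite g0 // add0r cuP.
  by rewrite -[ltLHS]add0r; move: k sk; near: e; exact: nears.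
move=> i; pose neg j := (AR *m y j) i 0 < 0.
exists (e / u i *: (row i AR)^T - \sum_(j in s | neg j) y j).
have E k : (AR *m (e / u i *: (row i AR)^T - \sum_(j in s | neg j) y j)) k 0 =
    e / u i * (row k AR *m (row i AR)^T) 0 0
    + \sum_(j in s | neg j) - (AR *m y j) k 0.
  rewrite mulmxBr -scalemxAr mulmx_sumr mxE [X in X + _]mxE [X in _ + X]mxE.
  rewrite summxE sumrN; congr (_ * _ - _).
  by rewrite -[in RHS]row_mul [RHS]mxE.
split=> k; rewrite finset.inE => ki; rewrite E wE addrC.
  rewrite (eqP ki) usq; congr (_ + _); last first.
    by rewrite expr2 mulrA divfK // gt_eqF.
  rewrite /g big_mkcondr; apply: eq_bigr => j _; rewrite /neg.
  case: ltP => h; first by rewrite max_r // oppr_ge0 ltW.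
  by rewrite max_l // oppr_le0.
apply: ler_ltD.
  rewrite /g big_mkcondr; apply: ler_sum => j _.
  by case: ifP => _; rewrite le_max lexx ?orbT.
by rewrite -mulrA ltr_pM2l // ltr_pdivrMl // mulrC uu.
Unshelve. all: by end_near. Qed.

End Configuration.

(** * Index sets and the sets of vectors they generate *)

Section Bridge.
Variables (R : realType) (m n : nat) (A : 'M[int]_(m, n)).
Local Notation AR := (toR R A).
Implicit Types s t : {set 'I_m}.

Definition rowset s : set 'rV[int]_n := [set row i A | i in [set` s]].

Lemma rowset_subrows s : [set` subrows A s] = rowset s.
Proof.
apply/seteqP; split=> v /=.
  by move=> /mapP[i]; rewrite mem_enum => si ->; exists i.
by move=> [i si <-]; apply/mapP; exists i; rewrite // mem_enum.
Qed.

Lemma rowsetT : rowset [set: 'I_m] = rows A.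
Proof.
apply/seteqP; split=> v /= [i _ <-]; first by exists i.
by exists i => //=; rewrite finset.inE.
Qed.

Lemma sub_rowset s t : s \subset t -> rowset s `<=` rowset t.
Proof.
by move=> /fintype.subsetP st _ [i /st ti <-]; exists i.
Qed.

Lemma rowset_rows s : rowset s `<=` rows A.
Proof. by rewrite -rowsetT; apply/sub_rowset/finset.subsetT. Qed.

Lemma finite_rowset s : finite_set (rowset s).
Proof. by apply: finite_image; exact: finite_finset. Qed.

Lemma sub_rows_rowset (V : set 'rV[int]_n) : V `<=` rows A ->
  exists s, V = rowset s.
Proof.
move=> VA; exists [set i | `[< V (row i A) >]]%SET; apply/seteqP; split=> v.
  move=> Vv; have [i _ iv] := VA v Vv; exists i => //=.
  by rewrite finset.inE iv; apply/asboolP.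
by move=> [i /=]; rewrite finset.inE => /asboolP Vi <-.
Qed.

Lemma cone_rowset s : cone R (rowset s) = conic AR s.
Proof.
apply/seteqP; split=> x.
  move=> [k [v [l [sv l0 ->]]]]; apply: conic_sum => i _; apply: conicZ => //.
  by have [j sj <-] := sv i; rewrite -row_toR; apply: conic_row.
move=> [l [sl l0 ->]].
exists #|s|, (fun k => row (enum_val k) A), (fun k => l 0 (enum_val k)); split.
- by move=> k; exists (enum_val k) => //=; exact: enum_valP.
- by move=> k.
rewrite mulmx_sum_row (bigID (mem s)) /= [X in _ + X]big1 => [|i /sl ->].
  rewrite addr0 (big_enum_val (fun i : 'I_m => l 0 i *: row i AR)) /=.
  by apply: eq_bigr => k _; rewrite row_toR.
by rewrite scale0r.
Qed.

Lemma nat_combinations_rowset s : nat_combinations (rowset s) = conic A s.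
Proof.
apply/seteqP; split=> z.
  move=> [k [v [l [sv ->]]]]; apply: conic_sum => i _; rewrite -scaler_nat.
  by apply: conicZ => //; have [j sj <-] := sv i; apply: conic_row.
move=> [l [sl l0 ->]].
exists #|s|, (fun k => row (enum_val k) A), (fun k => absz (l 0 (enum_val k))).
split; first by move=> k; exists (enum_val k) => //=; exact: enum_valP.
rewrite mulmx_sum_row (bigID (mem s)) /= [X in _ + X]big1 => [|i /sl ->].
  rewrite addr0 (big_enum_val (fun i : 'I_m => l 0 i *: row i A)) /=.
  apply: eq_bigr => k _; rewrite -scaler_nat; congr (_ *: _).
  by rewrite natz gez0_abs.
by rewrite scale0r.
Qed.

Lemma rows_cone s :
  rows A `&` lattice_points (cone R (rowset s)) = rowset (members R A s).
Proof.
rewrite cone_rowset; apply/seteqP; split=> v.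
  move=> [[i _ <-] ci]; exists i => //=; apply/in_members.
  by rewrite row_toR.
move=> [i /in_members ci <-]; split; first by exists i.
by rewrite /lattice_points /= -row_toR.
Qed.

Lemma hilbert_basis_rows s :
  hilbert_basis (rows A `&` lattice_points (cone R (rowset s)))
    (cone R (rowset s)) <-> hilbert_members R A s.
Proof.
rewrite rows_cone; split=> [[_ _ hb] z cz|hs].
  by rewrite -nat_combinations_rowset; apply: hb; rewrite cone_rowset.
split; first exact: finite_rowset.
- by rewrite -rows_cone; apply: subIsetr.
- by move=> z; rewrite nat_combinations_rowset cone_rowset => /hs.
Qed.

Lemma lin_indep_subrows s : lin_indep R (subrows A s) <-> indep AR s.
Proof.
pose X : #|s|.-tuple 'rV[R]_n := map_tuple (fun i => row i AR) (enum_tuple s).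
have -> : lin_indep R (subrows A s) <-> free X.
  rewrite /lin_indep /subrows -map_comp /X /=.
  by rewrite (eq_map (g := fun i => row i AR)) // => i; rewrite /= row_toR.
have nthX (k : 'I_#|s|) : X`_k = row k (subfamily AR s).
  rewrite /X /= (nth_map (enum_val k)) -?cardE //.
  by rewrite -enum_val_nth /subfamily row_rowsub.
have E (u : 'rV[R]_#|s|) : u *m subfamily AR s = \sum_k u 0 k *: X`_k.
  by rewrite mulmx_sum_row; apply: eq_bigr => k _; rewrite nthX.
rewrite indepP; split=> [/freeP fX|fr].
  rewrite -kermx_eq0; apply/rowV0P => u /sub_kermxP; rewrite E => /fX u0.
  by apply/rowP => k; rewrite u0 mxE.
apply/freeP => k; have := E (\row_i k i) => + e.
under eq_bigr do rewrite mxE.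
rewrite e => /eqP; rewrite mulmx_free_eq0 // => /eqP/rowP k0 i.
by have := k0 i; rewrite !mxE.
Qed.

Lemma size_subrows s : size (subrows A s) = #|s|.
Proof. by rewrite size_map -cardE. Qed.

Lemma nth_subrows s (k : 'I_(size (subrows A s))) :
  (subrows A s)`_k = row (enum_val (cast_ord (size_subrows s) k)) A.
Proof.
set k' := cast_ord _ k.
rewrite (nth_map (enum_val k')); last by rewrite -cardE -(size_subrows s).
by congr (row _ A); rewrite [RHS](enum_val_nth (enum_val k')).
Qed.

Lemma lattice_basis_subrows s :
  lattice_basis R (subrows A s) <-> indep AR s /\ spans_lattice A s.
Proof.
rewrite /lattice_basis lin_indep_subrows.
pose e := size_subrows s.
split=> -[ind la]; split=> // z.
  have [c ->] := la z.
  exists (\sum_k c k *: delta_mx 0 (enum_val (cast_ord e k))).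
    move=> i si; rewrite summxE big1 // => k _; rewrite !mxE eqxx /=.
    case: eqP => [ik|]; last by rewrite mulr0.
    by move: si; rewrite ik enum_valP.
  rewrite mulmx_suml; apply: eq_bigr => k _.
  by rewrite nth_subrows -scalemxAl -rowE.
have [c sc ->] := la z; exists (fun k => c 0 (enum_val (cast_ord e k))).
rewrite mulmx_sum_row (bigID (mem s)) /= [X in _ + X]big1 => [|i /sc ->].
  rewrite addr0 (big_enum_val (fun i : 'I_m => c 0 i *: row i A)) /=.
  rewrite (reindex (cast_ord e)) /=; last first.
    by exists (cast_ord (esym e)) => k _; rewrite ?cast_ordK ?cast_ordKV.
  by apply: eq_bigr => k _; rewrite nth_subrows.
by rewrite scale0r.
Qed.

Hypothesis A_inj : injective (fun i : 'I_m => row i A).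

Lemma subrows_uniq s : uniq (subrows A s).
Proof. by rewrite map_inj_uniq ?enum_uniq. Qed.

Lemma basis_in_rows (B : set 'rV[int]_n) : basis_in R (rows A) B <->
  exists s, [/\ B = rowset s, indep AR s & spans AR s].
Proof.
split=> [[BA [S [BS Sn ind]]]|[s [-> ind sp]]]; last first.
  split; first exact: rowset_rows.
  exists (subrows A s); split; rewrite ?rowset_subrows //.
    by rewrite size_subrows; apply/(indep_spans ind).
  exact/lin_indep_subrows.
have [s Bs] := sub_rows_rowset BA; exists s.
have Suniq : uniq S by have /free_uniq/map_uniq := ind.
have SE : perm_eq S (subrows A s).
  apply: uniq_perm => // [|v]; first exact: subrows_uniq.
  have : [set` S] v <-> [set` subrows A s] v by rewrite -BS rowset_subrows Bs.
  by move=> h; apply/idP/idP => /h.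
have inds : indep AR s.
  by apply/lin_indep_subrows; rewrite /lin_indep -(perm_free (perm_map _ SE)).
split=> //; apply/(indep_spans inds).
by rewrite -size_subrows -(perm_size SE).
Qed.

Hypothesis A_rank : \rank AR = n.

Lemma rows_spans : spans AR [set: 'I_m].
Proof.
move=> x; have /row_fullP[B BA] : row_full AR by rewrite /row_full A_rank.
exists (x *m B); first exact: supportedT.
by rewrite -mulmxA BA mulmx1.
Qed.

Lemma basis_hilbert :
  (forall B, basis_in R (rows A) B ->
    hilbert_basis (rows A `&` lattice_points (cone R B)) (cone R B)) <->
  (forall s, indep AR s -> spans AR s -> hilbert_members R A s).
Proof.
split=> [h s ind sp|h B /basis_in_rows[s [-> ind sp]]].
  by apply/hilbert_basis_rows; apply: h; apply/basis_in_rows; exists s.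
exact/hilbert_basis_rows/h.
Qed.

End Bridge.

(** * Triangulations *)

(** The coordinates of [x + e y] with respect to an independent family are
affine in [e], so their signs for arbitrarily small [e] decide those of [x]. *)
Lemma conic_limit (R : realType) (m n : nat) (M : 'M[R]_(m, n))
    (t : {set 'I_m}) (x y : 'rV[R]_n) : indep M t ->
  ~ (conic M t x /\ exists2 l, supported t l & y = l *m M) ->
  \forall e \near 0^'+, ~ conic M t (x + e *: y).
Proof.
move=> ind no.
have [[lx [ly [sx sy xl yl]]]|nspan] := pselect (exists lx ly,
    [/\ supported t lx, supported t ly, x = lx *m M & y = ly *m M]).
  have [j lxj] : exists j, lx 0 j < 0.
    apply: contrapT => h; apply: no; split; last by exists ly.
    exists lx; split => // j; rewrite leNgt; apply/negP => ?.
    by apply: h; exists j.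
  have := near0_lt (ly 0 j) 0 lxj; apply: filterS => e.
  rewrite mulr0 addr0 => lt0; rewrite xl yl scalemxAl -mulmxDl.
  move=> /(conic_indep ind (supportedD sx (supportedZ _ sy)))/(_ j).
  by rewrite mxE [X in _ + X]mxE leNgt lt0.
have [[e1 e10 [l [sl _ le1]]]|none] :=
    pselect (exists2 e1, 0 < e1 & conic M t (x + e1 *: y)); last first.
  by near=> e => ce; apply: none; exists e => //; near: e; exact: nbhs_right_gt.
near=> e => -[l' [sl' _ le]].
have ee1 : e < e1 by near: e; exact: nbhs_right_lt.
apply: nspan; pose ly := (e1 - e)^-1 *: (l - l').
have yl : y = ly *m M.
  rewrite -scalemxAl mulmxBl -le1 -le opprD addrACA subrr add0r -scalerBl.
  by rewrite scalerA mulVf ?scale1r // subr_eq0 gt_eqF.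
have sy : supported t ly by apply: supportedZ; apply: supportedB.
exists (l - e1 *: ly), ly; split => //.
  by apply: supportedB => //; apply: supportedZ.
by rewrite mulmxBl -scalemxAl -le1 -yl addrK.
Unshelve. all: by end_near. Qed.

Section Triangulations.
Variables (R : realType) (m n : nat) (A : 'M[int]_(m, n)).
Local Notation AR := (toR R A).
Hypothesis A_inj : injective (fun i : 'I_m => row i A).
Hypothesis A_prim : forall i : 'I_m, primitive_vec (row i A).
Hypothesis A_rank : \rank AR = n.
Implicit Types (s t : {set 'I_m}) (T : {set {set 'I_m}}).

(** A lattice point of a cone lies in the cone of an independent subset, which
is a face of some basis cone; the generators that a nonnegative combination
inside that basis cone uses must lie in the same face. *)
Lemma basis_supernormal :
  (forall s, indep AR s -> spans AR s -> hilbert_members R A s) ->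
  supernormal R (rows A).
Proof.
move=> hb V VA; have [s ->] := sub_rows_rowset VA.
apply/hilbert_basis_rows => z /caratheodory[t [ts indt ct]].
have [t' [tt' ind sp]] := indep_extend (rows_spans A_rank) indt.
have [l [sl l0 zl]] := hb t' ind sp z (conicS tt' ct).
have /choice[a aP] : forall i, exists a : 'rV[R]_m,
    [/\ supported t' a, forall j, 0 <= a 0 j &
        i \in members R A t' -> row i AR = a *m AR].
  move=> i; have [/in_members[a [sa a0 ia]]|_] := boolP (i \in members R A t').
    by exists a.
  by exists 0; split=> // [|j]; [exact: supported0|rewrite mxE].
have [k [sk _ zk]] := ct.
have kE : k = \sum_i (l 0 i)%:~R *: a i.
  apply: (indep_inj ind).
  - exact: supported_sub sk.
  - move=> j tj; rewrite summxE big1 // => i _.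
    by have [sa _ _] := aP i; rewrite mxE sa // mulr0.
  rewrite -zk zl toRM mulmx_sum_row mulmx_suml; apply: eq_bigr => i _.
  rewrite -scalemxAl mxE; have [_ _ ia] := aP i.
  by have [/ia ->|/sl ->] := boolP (i \in members R A t'); rewrite ?scale0r.
exists l; split => // i; apply: contraNeq => li.
have it' : i \in members R A t' by apply: contraNT li => /sl ->.
have [sa a0 ia] := aP i; apply/in_members; apply: (conicS ts).
exists (a i); split => //; last exact: ia.
move=> j tj; have := sk j tj; rewrite kE summxE => /psumr_eq0P.
move=> /(_ _ i isT); rewrite mxE => /(_ _)/eqP.
rewrite mulf_eq0 intr_eq0 (negPf li) /= => /(_ _)/eqP; apply => i' _.
by have [_ a'0 _] := aP i'; rewrite mxE mulr_ge0 // ler0z.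
Qed.

Lemma face_coneE s : face_cone R A s = conic AR s.
Proof. by rewrite /face_cone rowset_subrows cone_rowset. Qed.

(** Near a relative interior point of a maximal simplex the covering cones are
finitely many, so one of them contains the point together with arbitrarily
small displacements in a direction outside the simplex; it would be a larger
simplex of the complex. *)
Lemma triangulation_pure T s : triangulation R A T ->
  maxset (fun t => t \in T) s -> spans AR s.
Proof.
move=> [_ indT cover inter] /maxsetP[sT smax].
have ind t : t \in T -> indep AR t by move=> /indT/lin_indep_subrows.
apply: contrapT => nsp.
have [i iP] : exists i, ~ exists2 l, supported s l & row i AR = l *m AR.
  apply: contrapT => h; apply: nsp.
  apply: (rows_spans_sub (rows_spans A_rank)) => i.
  by apply: contrapT => hi; apply: h; exists i.
(* The sum [x] of the rows of [s] is interior to [cone s]: a face of [s] that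
   contains it is [s] itself. *)
pose one : 'rV[R]_m := \row_j (j \in s)%:R.
have s1 : supported s one by move=> j /negPf sj; rewrite mxE sj.
pose x := one *m AR.
have xs : conic AR s x.
  by exists one; split => // j; rewrite mxE ler0n.
have [t tT [xt yt]] : exists2 t, t \in T &
    conic AR t x /\ exists2 l, supported t l & row i AR = l *m AR.
  apply: contrapT => h.
  have : \forall e \near 0^'+, forall t, t \in T ->
      ~ conic AR t (x + e *: row i AR).
    apply: filter_forall => t.
    have [tT|tT] := boolP (t \in T); last by near=> e.
    near=> e => _; near: e; apply: conic_limit; first exact: ind.
    by move=> ht; apply: h; exists t.
  move=> ne; near (0 : R)^'+ => e.
  have e0 : 0 < e by near: e; exact: nbhs_right_gt.
  have : cone R (rows A) (x + e *: row i AR).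
    rewrite -rowsetT cone_rowset; apply: conicD.
      exact: conicS (finset.subsetT _) xs.
    by apply: conicZ (ltW e0) _; apply: conic_row; rewrite finset.inE.
  rewrite cover => -[t /= tT]; rewrite face_coneE; move: t tT.
  by near: e.
have st : s \subset t.
  have [l [sl _ xl]] : conic AR (s :&: t) x.
    by rewrite -face_coneE -inter //; split; rewrite face_coneE.
  have l1 : one = l.
    apply: (indep_inj (ind _ sT) s1 _ xl).
    exact: supported_sub (finset.subsetIl _ _) sl.
  apply/fintype.subsetP => j sj; apply: contraT => tj.
  have := sl j; rewrite !finset.inE (negPf tj) andbF -l1 mxE sj => /(_ isT)/eqP.
  by rewrite oner_eq0.
by apply: iP; rewrite -(smax t tT st).
Unshelve. all: by end_near. Qed.

(** All rows are used, so a row in the cone of a simplex belongs to it: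
the cones of the simplex and of the row meet in the cone of a common face. *)
Lemma basis_unimodular :
  (forall s, indep AR s -> spans AR s -> hilbert_members R A s) ->
  forall T, triangulation R A T -> uses_all T -> unimodular R A T.
Proof.
move=> hb T Ttri Tall s smax.
have sp := triangulation_pure Ttri smax.
have [down indT _ inter] := Ttri; have [sT _] := maxsetP smax.
have ind : indep AR s by apply/lin_indep_subrows/indT.
apply/lattice_basis_subrows; split => //.
apply: empty_spans_lattice (hb s ind sp) => //.
apply/fintype.subsetP => i /in_members ci; apply: contraT => si.
have [t tT ti] := Tall i.
have iT : [set i]%SET \in T by apply: down tT _; rewrite finset.sub1set.
have : conic AR (s :&: [set i]) (row i AR).
  rewrite -face_coneE -inter //; split; rewrite face_coneE //.
  by apply: conic_row; rewrite finset.inE.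
move=> [l [sl _]]; have -> : l = 0.
  apply/rowP => j; rewrite mxE; apply: sl; rewrite !finset.inE.
  by case: eqP => [->|]; rewrite ?andbF // andbT.
by rewrite mul0mx => /eqP; rewrite (negPf (row_neq0 R A_prim i)).
Qed.

(** After a small perturbation that makes the weights generic, the family of
all cells is a regular triangulation that still contains [s] and every single
vector. *)
Lemma regular_unimodular_empty :
  (forall T, triangulation R A T -> regular_complex R A T -> uses_all T ->
    unimodular R A T) ->
  forall s, indep AR s -> spans AR s -> members R A s \subset s ->
    hilbert_members R A s.
Proof.
move=> uni s ind sp ms.
have [w0 w0P] := empty_basis_weights A_inj A_prim ind sp ms.
(* A cell that is dependent would make [w] orthogonal to its dependences, so it
   is enough to avoid one dependence for each dependent set. *)
have /choice[f fP] : forall t, exists v : 'rV[R]_m, ~ indep AR t ->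
    [/\ supported t v, v *m AR = 0 & v != 0].
  move=> t; have [it|nit] := pselect (indep AR t); first by exists 0.
  apply: contrapT => h; apply: nit => v sv v0; apply: contrapT => /eqP vn0.
  by apply: h; exists v.
pose C w := cell AR w s /\ forall i, cell AR w [set i].
pose L := [seq f t | t <- enum {set 'I_m} & f t != 0].
have [|||w [ws w1] wL] := @generic_weights R m C L w0.
- move=> w d [ws w1].
  have : \forall e \near 0^'+, forall i, cell AR (w + e *: d) [set i].
    by apply: filter_forall => i; apply: cell_open => //; exact: indep1.
  by apply: filterS2 (cell_open d ind ws) => e.
- by move=> v /mapP[t]; rewrite mem_filter => /andP[ft _] ->.
- exact: w0P.
have indT t : cell AR w t -> indep AR t.
  move=> [c [ct _]]; apply: contrapT => nit; have [sv v0 vn0] := fP t nit.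
  have : f t \in L by apply/mapP; exists t; rewrite // mem_filter vn0 mem_enum.
  move=> /wL/eqP; apply.
  have e : (f t *m (AR *m c)) 0 0 = 0 by rewrite mulmxA v0 mul0mx mxE.
  rewrite -[RHS]e !mulmx1E; apply: eq_bigr => i _.
  by have [/ct ->|/sv ->] := boolP (i \in t); rewrite ?mul0r.
pose T := [set t | `[< cell AR w t >]]%SET.
have inT t : t \in T <-> cell AR w t.
  by rewrite finset.inE; split=> /asboolP.
have Ttri : triangulation R A T.
  split.
  - by move=> t t' /inT ct t't; apply/inT; exact: cell_sub (indT _ ct) t't ct.
  - by move=> t /inT/indT/lin_indep_subrows.
  - rewrite -rowsetT cone_rowset; apply/seteqP; split=> x.
      have [c [cs cn]] := ws.
      move=> /(conic_cover (cell_le cs cn))[t ct xt].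
      by exists t => /=; [exact/inT|rewrite face_coneE].
    by move=> [t _]; rewrite face_coneE => /(conicS (finset.subsetT t)).
  - move=> t t' /inT ct /inT ct'; rewrite !face_coneE.
    apply/seteqP; split=> x.
      by move=> [ctx ct'x]; exact: cell_conicI ct ct' ctx ct'x.
    move=> cx; split; apply: conicS cx; first exact: finset.subsetIl.
    exact: finset.subsetIr.
have smax : maxset (fun t => t \in T) s.
  apply/maxsetP; split; first exact/inT.
  move=> t /inT/indT/indep_card tn st; apply/eqP; rewrite eq_sym eqEcard st /=.
  by have /(indep_spans ind) -> := sp.
have /lattice_basis_subrows[_] : lattice_basis R (subrows A s).
  apply: (uni T) => //; first by exists (fun i => w i 0).
  by move=> i; exists [set i]%SET; [exact/inT|rewrite finset.inE].
exact: spans_lattice_hilbert.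
Qed.

End Triangulations.

(** * Minimal Hilbert bases and basis normalization *)

Section NatCombinations.
Variables (n : nat).
Implicit Types (S : set 'rV[int]_n) (z : 'rV[int]_n).

Lemma nat_combinations_ind S (P : 'rV[int]_n -> Prop) :
  P 0 -> (forall v z, S v -> P z -> P (v + z)) ->
  nat_combinations S `<=` P.
Proof.
move=> P0 PD _ [k [v [l [Sv ->]]]].
elim/big_rec: _ => // i z _ Pz.
elim: (l i) => [|c IH]; first by rewrite mulr0n add0r.
by rewrite mulrS -addrA; apply: PD.
Qed.

Lemma nat_combinations0 S : nat_combinations S 0.
Proof.
exists 0%N, (fun=> 0), (fun=> 0%N); split; first by case.
by rewrite big_ord0.
Qed.

Lemma nat_combinations_add S v z :
  S v -> nat_combinations S z -> nat_combinations S (v + z).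
Proof.
move=> Sv [k [f [l [Sf ->]]]].
exists k.+1, (fun i => oapp f v (unlift ord0 i)),
  (fun i => oapp l 1%N (unlift ord0 i)); split.
  by move=> i; case: unliftP => [j|] _ /=.
rewrite big_ord_recl unlift_none /= mulr1n; congr (_ + _).
by apply: eq_bigr => i _; rewrite liftK.
Qed.

Lemma nat_combinationsD S y z :
  nat_combinations S y -> nat_combinations S z -> nat_combinations S (y + z).
Proof.
move=> Sy Sz; move: y Sy; apply: nat_combinations_ind.
  by rewrite add0r.
by move=> v y Sv; rewrite -addrA; exact: nat_combinations_add.
Qed.

Lemma nat_combinations_trans S S' :
  S `<=` nat_combinations S' -> nat_combinations S `<=` nat_combinations S'.
Proof.
move=> SS'; apply: nat_combinations_ind; first exact: nat_combinations0.
by move=> v z /SS'; exact: nat_combinationsD.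
Qed.

Lemma nat_combinations_gen S : S `<=` nat_combinations S.
Proof.
move=> v Sv; rewrite -[v]addr0; apply: nat_combinations_add => //.
exact: nat_combinations0.
Qed.

Lemma finite_bounded_vectors (N : nat) :
  finite_set [set z : 'rV[int]_n | forall j, (absz (z 0%R j) <= N)%N].
Proof.
pose f (u : {ffun 'I_n -> 'I_(N + N).+1}) : 'rV[int]_n :=
  \row_j ((u j)%:Z - N%:Z).
apply: (@sub_finite_set _ _ (range f)); last exact: finite_image.
move=> z zN; exists [ffun j => inord (absz (z 0 j + N%:Z))] => //.
apply/rowP => j; rewrite mxE ffunE inordK.
  by have := zN j; lia.
by have := zN j; lia.
Qed.

End NatCombinations.

(** Discard vectors from a finite Hilbert basis as long as possible. *)
Lemma min_hilbert_basis_sub (R : realType) (n : nat) (H : set 'rV[int]_n)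
    (K : set 'rV[R]_n) : hilbert_basis H K ->
  exists2 H', H' `<=` H & min_hilbert_basis H' K.
Proof.
move=> HK; have [fH _ _] := HK; have /finite_seqP[r rE] := fH.
rewrite {}rE {fH} in HK *.
have [k] := ubnP (size r); elim: k r HK => // k IH r HK rk.
have [mini|] := pselect (forall H', hilbert_basis H' K -> H' `<=` [set` r] ->
  H' = [set` r]); first by exists [set` r].
move=> /existsNP[H' /not_implyP[H'K /not_implyP[H'r ne]]].
pose r' := [seq v <- r | `[< H' v >]].
have r'E : [set` r'] = H'.
  apply/seteqP; split=> v /=; rewrite mem_filter.
    by move=> /andP[/asboolP].
  by move=> H'v; rewrite asboolT //=; exact: H'r.
have [||H'' H''r' minH''] := IH r'.
- by rewrite r'E.
- rewrite ltnS in rk; apply: leq_trans rk.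
  rewrite size_filter ltn_neqAle count_size andbT.
  apply/negP; rewrite -all_count => /allP allr; apply: ne; apply/seteqP.
  by split=> // v /allr/asboolP.
exists H'' => //; apply: subset_trans H''r' _.
by rewrite r'E.
Qed.

Section Normalization.
Variables (R : realType) (m n : nat) (A : 'M[int]_(m, n)).
Local Notation AR := (toR R A).
Hypothesis A_inj : injective (fun i : 'I_m => row i A).
Hypothesis A_prim : forall i : 'I_m, primitive_vec (row i A).
Hypothesis A_rank : \rank AR = n.
Implicit Types (s t : {set 'I_m}) (H : set 'rV[int]_n).

(** The fundamental parallelepiped is bounded, so its lattice points are finitely
many; subtracting the integer parts of the coordinates reaches them. *)
Lemma simplicial_hilbert_basis s : indep AR s ->
  exists H, hilbert_basis H (conic AR s).
Proof.
move=> ind.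
pose H : set 'rV[int]_n := [set z | exists l : 'rV[R]_m,
  [/\ supported s l, forall i, 0 <= l 0 i <= 1 & toR R z = l *m AR]].
exists H; split.
- apply: (sub_finite_set _
    (@finite_bounded_vectors n (\sum_i \sum_j absz (A i j)))).
  move=> z [l [sl l01 zl]] j /=.
  have : `|(z 0 j)%:~R : R| <= (\sum_i \sum_j absz (A i j))%:R.
    have -> : (z 0 j)%:~R = (l *m AR) 0 j by rewrite -zl mxE.
    rewrite mxE natr_sum; apply: le_trans (ler_norm_sum _ _ _) _.
    apply: ler_sum => i _; rewrite normrM.
    have /andP[l0 l1] := l01 i; rewrite ger0_norm //.
    apply: le_trans (ler_piMl _ l1) _; first exact: normr_ge0.
    rewrite mxE -intr_norm -abszE natr_sum (bigD1 j) //= lerDl.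
    by apply: sumr_ge0.
  by rewrite -intr_norm -abszE (ler_int _ _ (_%:Z)).
- move=> z [l [sl l01 zl]]; exists l; split => // i.
  by have /andP[] := l01 i.
move=> z [l [sl l0 zl]].
pose k : 'rV[int]_m := \row_i Num.floor (l 0 i).
have sk : supported s k by move=> i si; rewrite mxE sl // floor0.
have -> : z = (z - k *m A) + k *m A by rewrite subrK.
apply: nat_combinationsD.
  apply: nat_combinations_gen; exists (l - toR R k); split.
  - by apply: supportedB => //; exact: supported_toR.
  - move=> i; have /andP[fl fu] := floor_itv (l 0 i).
    move: fu; rewrite intrD !mxE; lra.
  - by rewrite mulmxBl -zl -toRM /toR map_mxB.
have : nat_combinations (rowset A s) (k *m A).
  rewrite nat_combinations_rowset; exists k; split => // i.
  by rewrite mxE floor_ge0.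
apply: nat_combinations_trans => _ [i si <-]; apply: nat_combinations_gen.
exists (delta_mx 0 i); split; first exact: supported_delta.
  by move=> j; rewrite mxE ler0n lern1 leq_b1.
by rewrite -rowE row_toR.
Qed.

Lemma conic_pointed s (x y : 'rV[R]_n) : indep AR s ->
  conic AR s x -> conic AR s y -> x + y = 0 -> x = 0.
Proof.
move=> ind [l [sl l0 ->]] [l' [sl' l'0 ->]]; rewrite -mulmxDl.
move=> /(ind _ (supportedD sl sl')) e.
suff -> : l = 0 by rewrite mul0mx.
apply/rowP => i; have := congr1 (fun x : 'rV__ => x 0 i) e; rewrite !mxE.
by move/eqP; rewrite paddr_eq0 // => /andP[/eqP].
Qed.

Lemma nat_combinations_conic s H :
  (forall v, H v -> conic AR s (toR R v)) ->
  forall z, nat_combinations H z -> conic AR s (toR R z).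
Proof.
move=> Hs; apply: nat_combinations_ind.
  by rewrite /toR map_mx0; exact: conic0.
by move=> v z /Hs Hv Hz; rewrite /toR map_mxD; exact: conicD.
Qed.

(** The rays of a simplicial cone are extreme, so a combination that lands on a
ray only uses multiples of its primitive generator. *)
Lemma hilbert_basis_generator s H i : indep AR s -> i \in s ->
  hilbert_basis H (conic AR s) -> H (row i A).
Proof.
move=> ind si [_ HK KH]; apply: contrapT => nH.
(* The functional [phi] sums the coordinates other than the one at [i]; it is
   nonnegative on the cone and vanishes on the ray of [a_i] only. *)
have [c cP] := indep_lift (fun j => (j != i)%:R : R) ind.
pose phi (z : 'rV[int]_n) := (toR R z *m c) 0 0.
have phiD y z : phi (y + z) = phi y + phi z.
  by rewrite /phi /toR map_mxD mulmxDl mxE.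
have [p Ap] := row_bezout A_prim i.
pose P z := 0 <= phi z /\ (phi z = 0 -> exists2 k, k != 1%N & z = row i A *+ k).
have phil (l : 'rV[R]_m) : supported s l ->
    (l *m AR *m c) 0 0 = \sum_j l 0 j * (j != i)%:R.
  move=> sl; rewrite -mulmxA mulmx1E; apply: eq_bigr => j _.
  by have [/cP ->|/sl ->] := boolP (j \in s); rewrite ?mul0r.
have PH v : H v -> P v.
  move=> Hv; have [l [sl l0 vl]] := HK v Hv; rewrite /P /phi vl phil //.
  split; first by apply: sumr_ge0 => j _; rewrite mulr_ge0 ?ler0n.
  move=> /psumr_eq0P l0i.
  have lE : l = l 0 i *: delta_mx 0 i.
    apply/rowP => j; rewrite !mxE eqxx /=; have [->|ji] := eqVneq j i.
      by rewrite mulr1.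
    have := l0i _ j isT; rewrite ji mulr1 mulr0; apply => k _.
    by rewrite mulr_ge0 ?ler0n.
  have vi : toR R v = l 0 i *: row i AR by rewrite vl {1}lE -scalemxAl -rowE.
  have li : l 0 i = ((v *m p) 0 0)%:~R.
    have := congr1 (fun x => (x *m toR R p) 0 0) vi.
    rewrite row_toR -scalemxAl -!toRM mxE => ->.
    by rewrite mxE -row_mul [X in _ * X]mxE [X in _ * X%:~R]mxE Ap mulr1.
  have : v = (v *m p) 0 0 *: row i A.
    by apply: (@toR_inj R); rewrite vi li row_toR /toR map_mxZ.
  have : 0 <= (v *m p) 0 0 by rewrite -(ler0z R) -li.
  case: ((v *m p) 0 0) => // k _ vk; exists k; last first.
    by rewrite -scaler_nat natz.
  by apply/eqP => k1; apply: nH; rewrite k1 scale1r in vk; rewrite -vk.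
have KA : conic AR s (toR R (row i A)) by rewrite -row_toR; apply: conic_row.
have Pall : nat_combinations H `<=` P.
  apply: nat_combinations_ind.
    split; first by rewrite /phi /toR map_mx0 mul0mx mxE.
    by move=> _; exists 0%N.
  move=> v z /PH[v0 vE] [z0 zE]; split; first by rewrite phiD addr_ge0.
  rewrite phiD => /eqP; rewrite paddr_eq0 //.
  move=> /andP[/eqP/vE[k k1 ->] /eqP/zE[l l1 ->]].
  exists (k + l)%N; last by rewrite mulrnDr.
  by move: k1 l1; case: k l => [|[|k]] [|[|l]].
have [_ []] := Pall _ (KH _ KA).
  rewrite /phi -row_toR rowE phil; last exact: supported_delta.
  apply: big1 => j _; rewrite mxE eqxx /=; case: (j == i); rewrite ?mulr0 //.
  by rewrite mul0r.
have rowp : (row i A *m p) 0 0 = 1 by rewrite -row_mul mxE.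
move=> k k1 /(congr1 (fun x => (x *m p) 0 0)); rewrite -scaler_nat -scalemxAl.
rewrite [X in _ = X -> _]mxE rowp mulr1 natz => -[e].
by rewrite -e eqxx in k1.
Qed.

(** In a pointed cone a vector of a minimal Hilbert basis is irreducible; a
primitive generating set must therefore contain it. *)
Lemma min_hilbert_basis_primitive s H (G : {set 'I_m}) :
  indep AR s -> min_hilbert_basis H (conic AR s) ->
  hilbert_basis (rowset A G) (conic AR s) -> H `<=` rowset A G.
Proof.
move=> ind [[finH HK KH] minH] [_ GK KG] h Hh; apply: contrapT => nGh.
pose H' := H `&` [set v | v <> h].
have conicH z : nat_combinations H' z -> conic AR s (toR R z).
  by apply: nat_combinations_conic => v [/HK].
have sum0 y z : conic AR s (toR R y) -> conic AR s (toR R z) ->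
    y + z = 0 -> y = 0.
  move=> cy cz yz; apply: (@toR_inj R); rewrite [RHS]/toR map_mx0.
  apply: (conic_pointed ind cy cz).
  by rewrite -[LHS](map_mxD (intr : int -> R)) yz /toR map_mx0.
have split_h z : nat_combinations H z ->
    exists k r, nat_combinations H' r /\ z = h *+ k + r.
  move: z; apply: nat_combinations_ind.
    by exists 0%N, 0; split; [exact: nat_combinations0|rewrite addr0].
  move=> v z Hv [k [r [H'r ->]]]; have [->|vh] := eqVneq v h.
    by exists k.+1, r; rewrite mulrS addrA.
  exists k, (v + r); split; last by rewrite addrCA.
  by apply: nat_combinations_add => //; split => //; exact/eqP.
(* As [h] is not in [G], a vector of [G] that uses [h] has a nonzero rest beside
   it, so a combination of [G] equal to [h] cannot use [h]. *)
have H'h : nat_combinations H' h.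
  pose Q z := exists k r, [/\ nat_combinations H' r, z = h *+ k + r
    & k = 0%N \/ r <> 0].
  have QG v : rowset A G v -> Q v.
    move=> Gv; have [k [r [H'r vE]]] := split_h v (KH _ (GK v Gv)).
    exists k, r; split => //; case: k vE => [|k] vE; [by left|right] => r0.
    have [i Gi iv] := Gv; have [p Ap] := row_bezout A_prim i.
    have := congr1 (fun x => (x *m p) 0 0) vE.
    rewrite r0 addr0 -iv -row_mul [X in X = _ -> _]mxE Ap.
    rewrite -scaler_nat -scalemxAl [X in _ = X -> _]mxE natz.
    case: ((h *m p) 0 0) => // d [] /esym/eqP.
    rewrite muln_eq1 => /andP[/eqP k0 _].
    by apply: nGh; move: Gv; rewrite vE k0 r0 addr0 mulr1n.
  have Qall : nat_combinations (rowset A G) `<=` Q.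
    apply: nat_combinations_ind.
      exists 0%N, 0; split; [exact: nat_combinations0|by rewrite addr0|by left].
    move=> v z /QG[k [r [H'r -> kr]]] [l [q [H'q -> lq]]].
    exists (k + l)%N, (r + q); split; first exact: nat_combinationsD.
      by rewrite mulrnDr addrACA.
    case: kr lq => [->|r0] [->|q0]; [by left|right|right|right].
    - by rewrite addrC => /(sum0 _ _ (conicH _ H'q) (conicH _ H'r)).
    - by move=> /(sum0 _ _ (conicH _ H'r) (conicH _ H'q)).
    - by move=> /(sum0 _ _ (conicH _ H'r) (conicH _ H'q)).
  have [[|k] [r [H'r hE]]] := Qall _ (KG _ (HK _ Hh)).
    by rewrite hE mulr0n add0r.
  case=> // r0; case: r0; apply: (sum0 _ (h *+ k)); first exact: conicH.
    rewrite -scaler_nat natz /toR map_mxZ.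
    apply: conicZ; first by rewrite ler0n.
    exact: HK.
  by apply: (@addrI _ h); rewrite addr0 [RHS]hE mulrS -addrA [r + _]addrC.
have HH' : H' = H.
  apply: minH; last by move=> v [].
  split; first by apply: sub_finite_set finH => v [].
    by move=> v [/HK].
  apply: subset_trans KH _; apply: nat_combinations_trans => v Hv.
  have [->//|vh] := eqVneq v h; apply: nat_combinations_gen.
  by split => //; exact/eqP.
by have [] : H' h by rewrite HH'.
Qed.

(** Both directions compare the rows in a basis cone with a minimal Hilbert
basis of that cone. *)
Lemma ibn1_basis : rows A = ibn R A 1 <->
  (forall s, indep AR s -> spans AR s -> hilbert_members R A s).
Proof.
split=> [E s ind sp|hb].
  have [H0 H0K] := simplicial_hilbert_basis ind.
  have [H HH0 minH] := min_hilbert_basis_sub H0K; have [[_ HK KH] _] := minH.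
  have HA : H `<=` rowset A (members R A s).
    move=> h Hh; rewrite -rows_cone cone_rowset; split; last exact: HK.
    rewrite E; exists (rowset A s), H; split => //.
      by apply/(basis_in_rows R A_inj); exists s.
    by rewrite cone_rowset.
  move=> z cz; rewrite -nat_combinations_rowset.
  apply: nat_combinations_trans (KH z cz) => h /HA.
  exact: nat_combinations_gen.
have hbK s : indep AR s -> spans AR s ->
    hilbert_basis (rowset A (members R A s)) (conic AR s).
  move=> ind sp; have := hb s ind sp => /hilbert_basis_rows.
  by rewrite rows_cone cone_rowset.
apply/seteqP; split=> h.
  move=> [i _ <-].
  have [s [is_ ind sp]] :=
    indep_extend (rows_spans A_rank) (@indep1 R _ _ _ A_prim i).
  have [H _ minH] := min_hilbert_basis_sub (hbK s ind sp).
  exists (rowset A s), H; split; rewrite ?cone_rowset //.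
    by apply/(basis_in_rows R A_inj); exists s.
  apply: (hilbert_basis_generator ind _ minH.1).
  by rewrite -finset.sub1set.
move=> [B [H [/(basis_in_rows R A_inj)[s [-> ind sp]]]]].
rewrite cone_rowset => minH Hh.
have := min_hilbert_basis_primitive ind minH (hbK s ind sp) Hh.
exact: rowset_rows.
Qed.

End Normalization.

(** * Integer hulls and totally dual integral systems *)

Lemma toR_mulE (R : realType) (m n p : nat) (M : 'M[int]_(m, n))
    (N : 'M[int]_(n, p)) i j :
  (toR R M *m toR R N) i j = ((M *m N) i j)%:~R.
Proof. by rewrite -toRM mxE. Qed.

Section Hull.
Variables (R : realType).

Lemma conv_gen (V : lmodType R) (S : set V) : S `<=` conv S.
Proof.
move=> x Sx; exists 1%N, (fun=> x), (fun=> 1).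
by rewrite !big_ord1 scale1r; split => // i; rewrite ler01.
Qed.

Lemma conv_convex (V : lmodType R) (S : set V) (t : R) x y :
  0 <= t <= 1 -> conv S x -> conv S y -> conv S (t *: x + (1 - t) *: y).
Proof.
move=> /andP[t0 t1] [k [v [l [Sv l0 l1 ->]]]] [k' [v' [l' [Sv' l'0 l'1 ->]]]].
exists (k + k')%N,
  (fun i => match fintype.split i with inl j => v j | inr j => v' j end),
  (fun i => match fintype.split i with
            | inl j => t * l j | inr j => (1 - t) * l' j end).
have El j : fintype.split (lshift k' j) = inl j by rewrite (unsplitK (inl j)).
have Er j : fintype.split (rshift k j) = inr j by rewrite (unsplitK (inr j)).
split.
- by move=> i; case: fintype.split.
- by move=> i; case: fintype.split => j; rewrite mulr_ge0 // subr_ge0.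
- rewrite big_split_ord /=; under eq_bigr do rewrite El.
  under [X in _ + X]eq_bigr do rewrite Er.
  by rewrite -!mulr_sumr l1 l'1 !mulr1 subrKC.
rewrite big_split_ord /= !scaler_sumr; congr (_ + _).
  by apply: eq_bigr => j _; rewrite El scalerA.
by apply: eq_bigr => j _; rewrite Er scalerA.
Qed.

Lemma conv_set0 (V : lmodType R) (x : V) : ~ conv set0 x.
Proof.
move=> [[|k] [v [l [Sv _ l1 _]]]]; last by have := Sv ord0.
by move/eqP: l1; rewrite big_ord0 eq_sym oner_eq0.
Qed.

Variables (m n : nat).
Implicit Types (A : 'M[int]_(m, n)) (b : 'cV[int]_m).

Lemma polyhedronP A b (x : 'cV[R]_n) : polyhedron R A b x <->
  forall i, (toR R A *m x) i 0 <= (b i 0)%:~R.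
Proof. by split=> h i; have := h i; rewrite /= [toR R b i 0]mxE. Qed.

Lemma lattice_polyhedron A b (z : 'cV[int]_n) :
  lattice_points (polyhedron R A b) z <-> forall i, (A *m z) i 0 <= b i 0.
Proof.
rewrite /lattice_points /= polyhedronP.
by split=> h i; have := h i; rewrite toR_mulE ler_int.
Qed.

Lemma integer_hull_gen (Q : set 'cV[R]_n) z :
  lattice_points Q z -> integer_hull Q (toR R z).
Proof. by move=> Qz; apply: conv_gen; exists z. Qed.

Lemma integer_hull_sub A b :
  integer_hull (polyhedron R A b) `<=` polyhedron R A b.
Proof.
move=> x [k [v [l [Sv l0 l1 ->]]]]; apply/polyhedronP => i.
rewrite mulmx_sumr summxE -[leRHS]mul1r -[X in X * _]l1 mulr_suml.
apply: ler_sum => j _.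
rewrite -scalemxAr mxE ler_wpM2l //.
by have [z Qz <-] := Sv j; have /polyhedronP := Qz.
Qed.

(** Multiples of a recession direction other than integral ones are
interpolated between consecutive integral multiples. *)
Lemma integer_hull_recession A b x (d : 'cV[int]_n) (t : R) :
  integer_hull (polyhedron R A b) x -> (forall i, (A *m d) i 0 <= 0) ->
  0 <= t -> integer_hull (polyhedron R A b) (x + t *: toR R d).
Proof.
move=> hx Ad0 t0.
have shift (k : nat) : integer_hull (polyhedron R A b) (x + k%:R *: toR R d).
  have [p [v [l [Sv l0 l1 xE]]]] := hx.
  exists p, (fun i => v i + k%:R *: toR R d), l; split => // [i|].
    have [z /lattice_polyhedron Qz <-] := Sv i; exists (z + k%:R *: d).
      apply/lattice_polyhedron => j; rewrite mulmxDr -scalemxAr mxE.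
      rewrite [X in _ + X]mxE; apply: le_trans (Qz j).
      by rewrite gerDl mulr_ge0_le0.
    by rewrite /toR map_mxD map_mxZ /= rmorph_nat.
  rewrite xE; under [RHS]eq_bigr do rewrite scalerDr.
  by rewrite big_split /= -scaler_suml l1 scale1r.
pose k := Num.truncn t; pose f := t - k%:R.
have /andP[kt tk] : k%:R <= t < k.+1%:R by exact: truncn_itv.
have f01 : 0 <= 1 - f <= 1 by move: tk; rewrite -natr1 /f; lra.
have := conv_convex f01 (shift k) (shift k.+1).
congr (conv _ _); rewrite !scalerDr addrACA -scalerDl subrKC scale1r.
rewrite !scalerA -scalerDl; congr (_ + _ *: _).
by rewrite -natr1 /f; ring.
Qed.

End Hull.

(** The rank of an integral matrix is the same over the rationals, where the
kernel is found by elimination and its denominators can be cleared. *)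
Lemma integral_kernel (R : realType) (m n : nat) (A : 'M[int]_(m, n))
    (s : {set 'I_m}) : ~ spans (toR R A) s ->
  exists2 d : 'cV[int]_n, d != 0 & forall i, i \in s -> (A *m d) i 0 = 0.
Proof.
pose AQ : 'M[rat]_(m, n) := map_mx intr A.
have AE : subfamily (toR R A) s = map_mx ratr (subfamily AQ s).
  by apply/matrixP => i j; rewrite !mxE ratr_int.
move=> /spansP; rewrite /row_full AE mxrank_map => nfull.
have [c [cs c0]] : exists c : 'cV[rat]_n,
    (forall i, i \in s -> (AQ *m c) i 0 = 0) /\ c <> 0.
  apply: contrapT => h; apply: nfull; apply/spansP; apply: ker_spans => c cs.
  by apply: contrapT => c0; apply: h; exists c.
pose D : int := \prod_j denq (c j 0).
have D0 : D != 0 by apply/prodf_neq0 => j _; exact: denq_neq0.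
have /choice[d dE] : forall j, exists d : int, d%:~R = D%:~R * c j 0.
  move=> j; exists (numq (c j 0) * \prod_(i | i != j) denq (c i 0)).
  have -> : D = denq (c j 0) * \prod_(i | i != j) denq (c i 0).
    by rewrite /D (bigD1 j).
  by rewrite !intrM numqE; ring.
have dcol : map_mx intr (\col_j d j) = D%:~R *: c :> 'cV[rat]_n.
  by apply/colP => j; rewrite !mxE dE.
exists (\col_j d j).
  apply/eqP => d0; apply: c0; move: dcol; rewrite d0 map_mx0 => /esym/eqP.
  by rewrite scaler_eq0 intr_eq0 (negPf D0) => /eqP.
move=> i si; apply: (@intr_inj rat).
have -> : ((A *m \col_j d j) i 0)%:~R = (AQ *m (D%:~R *: c)) i 0.
  by rewrite -dcol -map_mxM [RHS]mxE.
by rewrite -scalemxAr mxE cs // mulr0.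
Qed.

Section Polyhedra.
Variables (R : realType) (m n : nat) (A : 'M[int]_(m, n)).
Local Notation AR := (toR R A).
Implicit Types (s : {set 'I_m}) (b : 'cV[int]_m) (x : 'cV[R]_n).

Definition tight_rows b x : {set 'I_m} :=
  [set i | (AR *m x) i 0 == (b i 0)%:~R]%SET.

(** Weak duality: a member of the cone of the active rows is constant on the
face, with a value that tightness forces to be its right-hand side. *)
Lemma supernormal_TDI b : supernormal R (rows A) -> tight R A b -> TDI R A b.
Proof.
move=> sn tb F [_ [c [d [_ FE]]]].
pose s := [set i | `[< forall x, F x -> (AR *m x) i 0 = (b i 0)%:~R >]]%SET.
have sP i : i \in s <-> forall x, F x -> (AR *m x) i 0 = (b i 0)%:~R.
  by rewrite finset.inE; split=> /asboolP.
have -> : active A b F = rowset A s.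
  apply/seteqP; split=> a.
    move=> [i [-> Fi]]; exists i => //=; apply/sP => x /Fi.
    by rewrite [toR R b i 0]mxE.
  move=> [i /= /sP Fi <-]; exists i; split=> // x /Fi ->.
  by rewrite [RHS]mxE.
have := sn _ (@rowset_rows _ _ A s); rewrite rows_cone.
have -> : members R A s = s; last by [].
apply/eqP; rewrite finset.eqEsubset sub_members andbT.
apply/fintype.subsetP => i /in_members[l [sl l0 il]]; apply/sP => x Fx.
have /polyhedronP Qx : polyhedron R A b x by move: Fx; rewrite FE => -[].
have rowE (y : 'cV[R]_n) : (AR *m y) i 0 = (l *m (AR *m y)) 0 0.
  by rewrite mulmxA -il -row_mul [RHS]mxE.
apply/eqP; rewrite eq_le Qx /=.
have [z [/lattice_polyhedron Qz <-]] := tb i.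
have -> : ((A *m z) i 0)%:~R = (AR *m toR R z) i 0 by rewrite toR_mulE.
rewrite !rowE !mulmx1E; apply: ler_sum => j _.
have [js|/sl ->] := boolP (j \in s); last by rewrite !mul0r.
by apply: ler_wpM2l => //; rewrite toR_mulE ((sP j).1 js x Fx) ler_int.
Qed.

(** If the active rows at a vertex [x] form a Hilbert basis of the
full-dimensional cone they generate, every unit vector is an integral
combination of them, which makes the coordinates of [x] integral combinations
of right-hand sides. *)
Lemma TDI_vertex b x : TDI R A b -> polyhedron R A b x ->
  spans AR (tight_rows b x) -> exists z, x = toR R z.
Proof.
move=> tdi Qx sp; have /polyhedronP Qx' := Qx; set s := tight_rows b x in sp.
have sE i : i \in s -> (AR *m x) i 0 = (b i 0)%:~R.
  by rewrite finset.inE => /eqP.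
(* The sum of the active rows exposes the vertex. *)
have Fx : face (polyhedron R A b) [set x].
  split; first by exists x.
  pose o : 'rV[R]_m := \row_i (i \in s)%:R.
  have o0 i : 0 <= o 0 i by rewrite mxE ler0n.
  exists (o *m AR), ((o *m toR R b) 0 0); split=> [y Qy|].
    by rewrite -mulmxA; apply: mulmx_le.
  apply/seteqP; split=> y /=.
    move=> ->; split=> //; rewrite -mulmxA !mulmx1E; apply: eq_bigr => i _.
    rewrite [o 0 i]mxE [toR R b i 0]mxE.
    by have [/sE ->//|] := boolP (i \in s); rewrite !mul0r.
  rewrite -mulmxA => -[Qy e]; apply: (spans_ker sp) => i si.
  have [|/eqP|e'] := mulmx_le_slack (l := o) o0 Qy _ i.
  - by rewrite e.
  - by rewrite mxE si oner_eq0.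
  - by rewrite e' mxE sE.
have act : active A b [set x] = rowset A s.
  apply/seteqP; split=> a.
    move=> [i [-> xi]]; exists i => //=; rewrite finset.inE.
    by rewrite (xi x erefl) [toR R b i 0]mxE.
  move=> [i /= /sE xi <-]; exists i; split=> // y ->.
  by rewrite xi [RHS]mxE.
have [_ _ hb] := tdi _ Fx.
have la : spans_lattice A s.
  apply: (hilbert_spans_lattice sp) => z cz.
  rewrite -nat_combinations_rowset -act.
  by apply: hb; rewrite act cone_rowset.
have /choice[c cP] : forall j : 'I_n, exists c : 'rV[int]_m,
    supported s c /\ delta_mx 0 j = c *m A.
  by move=> j; have [c ? ?] := la (delta_mx 0 j); exists c.
exists (\col_j (c j *m b) 0 0); apply/colP => j; rewrite mxE mxE.
have [sc cE] := cP j.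
have -> : x j 0 = (toR R (c j) *m (AR *m x)) 0 0.
  rewrite mulmxA -toRM -cE.
  have -> : toR R (delta_mx 0 j : 'rV_n) = delta_mx 0 j.
    by apply/rowP => k; rewrite !mxE; case: (_ && _).
  by rewrite -rowE mxE.
rewrite mulmx1E [(c j *m b) 0 0]mxE rmorph_sum; apply: eq_bigr => i _.
rewrite mxE /= intrM; have [/sE ->//|/sc ->] := boolP (i \in s).
by rewrite !mul0r.
Qed.

Lemma move_until_tight b x (d : 'cV[R]_n) : polyhedron R A b x ->
  (forall i, i \in tight_rows b x -> (AR *m d) i 0 = 0) ->
  (exists i, 0 < (AR *m d) i 0) ->
  exists t, [/\ 0 < t, polyhedron R A b (x + t *: d) &
    (#|tight_rows b x| < #|tight_rows b (x + t *: d)|)%N].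
Proof.
move=> /polyhedronP Qx ker [i di].
have E t j : (AR *m (x + t *: d)) j 0 = (AR *m x) j 0 + t * (AR *m d) j 0.
  by rewrite mulmxDr -scalemxAr mxE [X in _ + X]mxE.
have [||i0 [t [gi0 t0 ti0 tge]]] := @ratio_test _ _
    (fun j => (b j 0)%:~R - (AR *m x) j 0) (fun j => - (AR *m d) j 0).
- by move=> j; rewrite subr_ge0.
- by exists i; rewrite oppr_lt0.
have i0x : i0 \notin tight_rows b x.
  by apply: contraTN gi0 => /ker ->; rewrite oppr0 ltxx.
have tpos : 0 < t.
  rewrite lt_neqAle t0 andbT; apply: contra i0x => /eqP t00.
  by move: ti0; rewrite -t00 mul0r addr0 finset.inE => /subr0_eq ->.
exists t; split=> //.
  by apply/polyhedronP => j; rewrite E; have := tge j; lra.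
apply: proper_card; apply/properP; split.
  apply/fintype.subsetP => j xj; rewrite finset.inE E (ker _ xj) mulr0 addr0.
  by move: xj; rewrite finset.inE.
exists i0 => //; rewrite finset.inE E; apply/eqP; move: ti0; lra.
Qed.

Hypothesis A_rank : \rank AR = n.

(** As long as the tight rows at [x] do not span, [x] moves both ways along an
integral direction in their common kernel, until a new row becomes tight or for
ever; so [x] lies on a segment or on a ray that starts at points with more
tight rows. *)
Lemma integral_vertices b :
  (forall x, polyhedron R A b x -> spans AR (tight_rows b x) ->
    exists z, x = toR R z) ->
  integral_polyhedron (polyhedron R A b).
Proof.
move=> vert; apply/seteqP; split; last exact: integer_hull_sub.
move=> x; have [k] := ubnP (m - #|tight_rows b x|).
elim: k x => // k IH x xk Qx.
have [sp|nsp] := pselect (spans AR (tight_rows b x)).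
  have [z xz] := vert x Qx sp; rewrite xz; apply: integer_hull_gen.
  by rewrite /lattice_points /= -xz.
have [d d0 dker] := integral_kernel nsp.
have Ad (d' : 'cV[int]_n) i : (AR *m toR R d') i 0 = ((A *m d') i 0)%:~R.
  by rewrite toR_mulE.
have {d0 dker d} [d [dker dup]] : exists d : 'cV[int]_n,
    (forall i, i \in tight_rows b x -> (A *m d) i 0 = 0) /\
    exists i, 0 < (A *m d) i 0.
  have [up|nup] := pselect (exists i, 0 < (A *m d) i 0); first by exists d.
  exists (- d); split=> [i xi|]; first by rewrite mulmxN mxE dker // oppr0.
  apply: contrapT => ndown; move/eqP: d0; apply; apply: (@toR_inj R).
  rewrite [RHS]/toR map_mx0; apply: (spans_ker (rows_spans A_rank)) => i _.
  rewrite mulmx0 [RHS]mxE Ad; apply/eqP; rewrite intr_eq0 eq_le.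
  rewrite leNgt (introN idP) /=; last by move=> ?; apply: nup; exists i.
  rewrite leNgt; apply/negP => lt0; apply: ndown; exists i.
  by rewrite mulmxN mxE oppr_gt0.
have step (t : R) (y : 'cV[R]_n) :
    (#|tight_rows b x| < #|tight_rows b (x + t *: y)|)%N ->
    polyhedron R A b (x + t *: y) ->
    integer_hull (polyhedron R A b) (x + t *: y).
  move=> lt; apply: IH; move: lt xk; set a := #|_|; set c := #|_| => lt xk.
  have cm : (c <= m)%N by rewrite -[leqRHS]card_ord max_card.
  by lia.
have [||t [t0 Qt xt]] := move_until_tight (d := toR R d) Qx.
- by move=> i /dker; rewrite Ad => ->.
- by have [i] := dup; exists i; rewrite Ad ltr0z.
have h1 := step _ _ xt Qt.
have toRN : toR R (- d) = - toR R d by rewrite /toR map_mxN.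
have [down|ndown] := pselect (exists i, 0 < (A *m - d) i 0); last first.
  have -> : x = x + t *: toR R d + t *: toR R (- d).
    by rewrite toRN -addrA scalerN subrr addr0.
  apply: integer_hull_recession => //; last exact: ltW.
  by move=> i; rewrite leNgt; apply/negP => ?; apply: ndown; exists i.
have [||u [u0 Qu xu]] := move_until_tight (d := toR R (- d)) Qx.
- by move=> i /dker e; rewrite Ad mulmxN mxE e oppr0.
- by have [i] := down; exists i; rewrite Ad ltr0z.
have h2 := step _ _ xu Qu.
have tu : 0 < t + u by apply: addr_gt0.
have r01 : 0 <= u / (t + u) <= 1.
  by rewrite divr_ge0 ?(ltW u0) ?(ltW tu) //= ler_pdivrMr // mul1r lerDr ltW.
have := conv_convex r01 h1 h2; congr (conv _ _).
rewrite !scalerDr addrACA -scalerDl subrKC scale1r !scalerA.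
rewrite toRN scalerN -scalerBl (_ : _ - _ = 0) ?scale0r ?addr0 //.
by field; rewrite gt_eqF.
Qed.

Lemma TDI_integral b : TDI R A b -> integral_polyhedron (polyhedron R A b).
Proof. by move=> tdi; apply: integral_vertices => x; exact: TDI_vertex. Qed.

End Polyhedra.

(** * Rounded weights and small Chvatal rank *)

Lemma norm_mulmx (R : realType) (m n : nat) (M : 'M[R]_(m, n))
    (f : 'cV[R]_n) k :
  (forall j, `|f j 0| <= 1) -> `|(M *m f) k 0| <= \sum_j `|M k j|.
Proof.
move=> f1; rewrite mxE; apply: le_trans (ler_norm_sum _ _ _) _.
by apply: ler_sum => j _; rewrite normrM ler_piMr.
Qed.

Definition floor_col (R : realType) (n : nat) (x : 'cV[R]_n) : 'cV[int]_n :=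
  \col_j Num.floor (x j 0).

Lemma floor_colP (R : realType) (n : nat) (x : 'cV[R]_n) j :
  `|(x - toR R (floor_col x)) j 0| <= 1.
Proof.
have /andP[fl fu] := floor_itv (x j 0).
rewrite !mxE ger0_norm ?subr_ge0 //; move: fu; rewrite intrD; lra.
Qed.

Section Rounding.
Variables (R : realType) (m n : nat) (A : 'M[int]_(m, n)).
Local Notation AR := (toR R A).
Implicit Types (s : {set 'I_m}) (b : 'cV[int]_m) (w : 'cV[R]_m).

(** Near a large multiple of a functional that exposes the ray of [a_i] there
is a lattice point on the hyperplane of [a_i], since [a_i] is primitive; all
the other constraints have room for the bounded rounding error. *)
Lemma tight_near w : (forall i, primitive_vec (row i A)) ->
  (forall i, cell AR w [set i]) ->
  \forall e \near 0^'+, forall b,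
    (forall i, `|(b i 0)%:~R - w i 0 / e| <= 1) -> tight R A b.
Proof.
move=> A_prim w1.
have /choice[c cP] := w1.
have /choice[p pP] := row_bezout A_prim.
(* [N k] bounds the error in row [k] of rounding the coordinates of a point, and
   [K i k] the error after the correction that restores equality in row [i]. *)
pose N k := \sum_j `|AR k j|.
pose K i k := N k + (1 + N i) * `|((A *m p i) k 0)%:~R| + 1.
have : \forall e \near 0^'+, forall i k, k != i ->
    (AR *m c i) k 0 + e * K i k < w k 0 + e * 0.
  apply: filter_forall => i; apply: filter_forall => k.
  have [->|ki] := eqVneq k i; first by near=> e.
  near=> e => _; near: e; apply: near0_lt.
  by apply: (cP i).2; rewrite finset.inE.
move=> nearK; near=> e => b bw i.
have e0 : 0 < e by near: e; exact: nbhs_right_gt.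
have Ke : forall i k, k != i ->
    (AR *m c i) k 0 + e * K i k < w k 0 + e * 0.
  by near: e; exact: nearK.
pose x := e^-1 *: c i; pose q := floor_col x.
pose u := b i 0 - (A *m q) i 0.
exists (q + u *: p i).
have Az k : (A *m (q + u *: p i)) k 0 = (A *m q) k 0 + u * (A *m p i) k 0.
  by rewrite mulmxDr -scalemxAr mxE [X in _ + X]mxE.
have zi : (A *m (q + u *: p i)) i 0 = b i 0 by rewrite Az pP mulr1 subrKC.
split=> //; apply/lattice_polyhedron => k.
have [->|ki] := eqVneq k i; first by rewrite zi.
have Ax j : (AR *m x) j 0 = (AR *m c i) j 0 / e.
  by rewrite /x -scalemxAr mxE mulrC.
have Aq j : `|(AR *m x) j 0 - ((A *m q) j 0)%:~R| <= N j.
  have := norm_mulmx AR j (floor_colP x); rewrite mulmxBr mxE [X in _ + X]mxE.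
  by rewrite toR_mulE.
have ub : `|u%:~R : R| <= 1 + N i.
  have -> : u%:~R = ((b i 0)%:~R - w i 0 / e)
      + ((AR *m x) i 0 - ((A *m q) i 0)%:~R).
    by rewrite Ax (cP i).1 ?finset.inE // /u intrB; ring.
  by apply: le_trans (ler_normD _ _) _; apply: lerD.
have uk : u%:~R * ((A *m p i) k 0)%:~R <= (1 + N i) * `|((A *m p i) k 0)%:~R|.
  apply: le_trans (ler_norm _) _; rewrite normrM.
  by apply: ler_wpM2r.
have bk : w k 0 / e - 1 <= (b k 0)%:~R.
  by have := bw k; rewrite ler_norml => /andP[+ _]; lra.
have wk : (AR *m c i) k 0 / e + K i k <= w k 0 / e.
  have := Ke i k ki; rewrite mulr0 addr0 => /ltW.
  by rewrite ler_pdivlMr // mulrDl divfK ?gt_eqF // [K i k * e]mulrC.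
have := Aq k; rewrite Ax ler_norml => /andP[qk _].
rewrite Az -(ler_int R) intrD intrM; move: wk; rewrite /K; lra.
Unshelve. all: by end_near. Qed.

(** The vertex on the hyperplanes of [s] depends linearly on the right-hand
sides, so bounded changes of [w / e] cannot consume the room that the other
constraints have for small [e]. *)
Lemma vertex_near w s : indep AR s -> spans AR s -> cell AR w s ->
  \forall e \near 0^'+, forall b,
    (forall i, `|(b i 0)%:~R - w i 0 / e| <= 1) ->
    exists2 x, polyhedron R A b x &
      forall i, i \in s -> (AR *m x) i 0 = (b i 0)%:~R.
Proof.
move=> ind sp [c [cs cn]].
have /choice[l lP] : forall k, exists l : 'rV[R]_m,
    supported s l /\ row k AR = l *m AR.
  by move=> k; have [l ? ?] := sp (row k AR); exists l.
pose K k := \sum_j `|l k 0 j| + 1.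
have : \forall e \near 0^'+, forall k, k \notin s ->
    (AR *m c) k 0 + e * K k < w k 0 + e * 0.
  apply: filter_forall => k; have [ks|ks] := boolP (k \in s); first by near=> e.
  by near=> e => _; near: e; apply: near0_lt; exact: cn.
move=> nearK; near=> e => b bw.
have e0 : 0 < e by near: e; exact: nbhs_right_gt.
have Ke : forall k, k \notin s -> (AR *m c) k 0 + e * K k < w k 0 + e * 0.
  by near: e; exact: nearK.
have [x xs] := indep_lift (fun i => (b i 0)%:~R : R) ind.
exists x => //; apply/polyhedronP => k.
have [ks|ks] := boolP (k \in s); first by rewrite xs.
have [sl kl] := lP k.
have rowE (y : 'cV[R]_n) : (AR *m y) k 0 = \sum_j l k 0 j * (AR *m y) j 0.
  by rewrite -mulmx1E mulmxA -kl -row_mul [RHS]mxE.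
have xE : (AR *m x) k 0 = (AR *m c) k 0 / e
    + \sum_j l k 0 j * ((AR *m x) j 0 - (AR *m c) j 0 / e).
  under eq_bigr do rewrite mulrBr mulrA.
  by rewrite sumrB -mulr_suml -!rowE subrKC.
have le1 : \sum_j l k 0 j * ((AR *m x) j 0 - (AR *m c) j 0 / e)
    <= \sum_j `|l k 0 j|.
  apply: ler_sum => j _; have [js|/sl ->] := boolP (j \in s); last first.
    by rewrite mul0r.
  apply: le_trans (ler_norm _) _; rewrite normrM xs // cs //.
  by rewrite ler_piMr.
have bk : w k 0 / e - 1 <= (b k 0)%:~R.
  by have := bw k; rewrite ler_norml => /andP[+ _]; lra.
have wk : (AR *m c) k 0 / e + K k <= w k 0 / e.
  have := Ke k ks; rewrite mulr0 addr0 => /ltW.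
  by rewrite ler_pdivlMr // mulrDl divfK ?gt_eqF // [K k * e]mulrC.
by rewrite xE; move: wk; rewrite /K; lra.
Unshelve. all: by end_near. Qed.

(** Only lattice points of a face contribute to a convex combination that lies
on the face. *)
Lemma integral_face_point b x s : integral_polyhedron (polyhedron R A b) ->
  polyhedron R A b x -> (forall i, i \in s -> (AR *m x) i 0 = (b i 0)%:~R) ->
  exists z : 'cV[int]_n, forall i, i \in s -> (A *m z) i 0 = b i 0.
Proof.
move=> QE; rewrite {1}QE => -[k [v [l [Sv l0 l1 xE]]]] xs.
have [t lt] : exists t, l t != 0.
  apply: contrapT => h; have := l1; rewrite big1 => [/esym/eqP|t _].
    by rewrite oner_eq0.
  by apply: contrapT => /eqP lt; apply: h; exists t.
have [z _ vz] := Sv t; exists z => i si; apply: (@intr_inj R).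
have le0 (t' : 'I_k) : 0 <= l t' * ((b i 0)%:~R - (AR *m v t') i 0).
  rewrite mulr_ge0 // subr_ge0.
  by have [z' /polyhedronP Qz' <-] := Sv t'.
have sum0 : \sum_t' l t' * ((b i 0)%:~R - (AR *m v t') i 0) = 0.
  under eq_bigr do rewrite mulrBr.
  rewrite sumrB -mulr_suml l1 mul1r -(xs i si) xE mulmx_sumr summxE.
  apply/eqP; rewrite subr_eq0; apply/eqP; apply: eq_bigr => t' _.
  by rewrite -scalemxAr mxE.
have /eqP : l t * ((b i 0)%:~R - (AR *m v t) i 0) = 0.
  by apply: (psumr_eq0P _ sum0).
by rewrite mulf_eq0 (negPf lt) /= subr_eq0 -vz toR_mulE => /eqP.
Qed.

End Rounding.

Section IntegralityConverse.
Variables (R : realType) (m n : nat) (A : 'M[int]_(m, n)).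
Local Notation AR := (toR R A).
Hypothesis A_inj : injective (fun i : 'I_m => row i A).
Hypothesis A_prim : forall i : 'I_m, primitive_vec (row i A).
Implicit Types (s : {set 'I_m}) (b : 'cV[int]_m).

(** For suitable weights [w] and small [e], rounding [w / e] to integers in any
way gives a tight system with a vertex on the hyperplanes of [s]. Integrality
makes those vertices integral; two roundings that differ by one at [j] only
differ by a vector dual to [a_j], and these vectors read off the coordinates of
a lattice point as integers. *)
Lemma integral_empty_hilbert :
  (forall b, tight R A b -> integral_polyhedron (polyhedron R A b)) ->
  forall s, indep AR s -> spans AR s -> members R A s \subset s ->
    hilbert_members R A s.
Proof.
move=> integral s ind sp ms.
have [w [ws w1]] := empty_basis_weights A_inj A_prim ind sp ms.
near (0 : R)^'+ => e.
have tightP : forall b, (forall i, `|(b i 0)%:~R - w i 0 / e| <= 1) ->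
    tight R A b.
  by near: e; exact: tight_near.
have vertexP : forall b, (forall i, `|(b i 0)%:~R - w i 0 / e| <= 1) ->
    exists2 x, polyhedron R A b x &
      forall i, i \in s -> (AR *m x) i 0 = (b i 0)%:~R.
  by near: e; exact: vertex_near.
pose b0 (r : 'I_m -> bool) : 'cV[int]_m :=
  \col_i (Num.floor (w i 0 / e) + (r i)%:R).
have /choice[z zP] : forall r, exists z : 'cV[int]_n,
    forall i, i \in s -> (A *m z) i 0 = b0 r i 0.
  move=> r; have br i : `|(b0 r i 0)%:~R - w i 0 / e| <= 1.
    have /andP[fl fu] := floor_itv (w i 0 / e).
    rewrite mxE intrD; move: fu; rewrite intrD ler_norml.
    by case: (r i) => /=; lra.
  have [x Qx xs] := vertexP _ br.
  exact: integral_face_point (integral _ (tightP _ br)) Qx xs.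
pose y j := z (pred1 j) - z pred0.
have yP i j : i \in s -> (A *m y j) i 0 = (i == j)%:R.
  move=> si; rewrite mulmxBr mxE [X in _ + X]mxE !zP // !mxE.
  by rewrite mulr0n addr0 addrAC subrr add0r.
apply: spans_lattice_hilbert => // v; have [l sl vl] := sp (toR R v).
exists (\row_j if j \in s then (v *m y j) 0 0 else 0).
  by move=> j /negPf sj; rewrite mxE sj.
apply: (@toR_inj R); rewrite toRM vl; congr (_ *m _); apply/rowP => j.
rewrite [RHS]mxE [X in X%:~R]mxE.
have [sj|/sl ->//] := boolP (j \in s).
rewrite -[RHS]toR_mulE vl -mulmxA mulmx1E (bigD1 j) //= toR_mulE yP // eqxx.
rewrite mulr1 big1 ?addr0 // => i ij.
have [si|/sl ->] := boolP (i \in s); last by rewrite mul0r.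
by rewrite toR_mulE yP // (negPf ij) mulr0.
Unshelve. all: by end_near. Qed.

End IntegralityConverse.

Section Describes.
Variables (R : realType) (m n : nat) (A : 'M[int]_(m, n)).
Local Notation AR := (toR R A).
Implicit Types (b : 'cV[int]_m).

Lemma lattice_points_max b (z0 : 'cV[int]_n) i :
  lattice_points (polyhedron R A b) z0 ->
  exists2 z, lattice_points (polyhedron R A b) z &
    forall z', lattice_points (polyhedron R A b) z' ->
      (A *m z') i 0 <= (A *m z) i 0.
Proof.
move=> Qz0.
pose P k := `[< exists2 z, lattice_points (polyhedron R A b) z &
  b i 0 - (A *m z) i 0 = k%:Z >].
have slack z : lattice_points (polyhedron R A b) z ->
    exists k, b i 0 - (A *m z) i 0 = k%:Z.
  move=> /lattice_polyhedron/(_ i); rewrite -subr_ge0.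
  by case: (_ - _) => // k _; exists k.
have exP : exists k, P k.
  by have [k zk] := slack z0 Qz0; exists k; apply/asboolP; exists z0.
case: (ex_minnP exP) => k /asboolP[z Qz zk] kmin; exists z => // z' Qz'.
have [k' zk'] := slack z' Qz'.
have : (k <= k')%N by apply: kmin; apply/asboolP; exists z'.
by rewrite -lez_nat -zk -zk' lerD2l lerN2.
Qed.

(** Shrinking every right-hand side by the largest possible rounding error
leaves no real solution either, as rounding one would give a lattice point of
the original polyhedron. *)
Lemma no_lattice_points_empty b :
  (forall z, ~ lattice_points (polyhedron R A b) z) ->
  exists b', polyhedron R A b' = set0.
Proof.
move=> none; exists (b - \col_i \sum_j `|A i j|).
apply/seteqP; split=> // x /polyhedronP Qx; apply: (none (floor_col x)).
apply/lattice_polyhedron => i; rewrite -(ler_int R) -toR_mulE.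
have bE : ((b - \col_i \sum_j `|A i j|) i 0)%:~R =
    (b i 0)%:~R - \sum_j `|AR i j| :> R.
  rewrite mxE [X in _ + X]mxE [X in - X]mxE intrB rmorph_sum /=; congr (_ - _).
  by apply: eq_bigr => j _; rewrite mxE intr_norm.
have := norm_mulmx AR i (floor_colP x); rewrite mulmxBr mxE [X in _ + X]mxE.
by rewrite ler_norml => /andP[+ _]; have := Qx i; rewrite bE; lra.
Qed.

(** Lowering every right-hand side to the maximum over the lattice points makes
the system tight without losing any lattice point. *)
Lemma integral_describes (A_inj : injective (fun i : 'I_m => row i A)) :
  (forall b, tight R A b -> integral_polyhedron (polyhedron R A b)) ->
  forall b, describes_hull R A b 0.
Proof.
move=> integral b.
suff [b' hb'] : exists b', integer_hull (polyhedron R A b) = polyhedron R A b'.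
  by exists m, A, b'.
have [[z0 Qz0]|none] := pselect (exists z, lattice_points (polyhedron R A b) z).
  have /choice[z zP] : forall i, exists z : 'cV[int]_n,
      lattice_points (polyhedron R A b) z /\
      forall z', lattice_points (polyhedron R A b) z' ->
        (A *m z') i 0 <= (A *m z) i 0.
    by move=> i; have [z ? ?] := lattice_points_max i Qz0; exists z.
  pose b' : 'cV[int]_m := \col_i (A *m z i) i 0.
  have b'E i : b' i 0 = (A *m z i) i 0 by rewrite mxE.
  have same :
      lattice_points (polyhedron R A b') = lattice_points (polyhedron R A b).
    apply/seteqP; split=> z' Qz'; apply/lattice_polyhedron => i.
      have /lattice_polyhedron/(_ i) h := Qz'; apply: le_trans h _.
      by rewrite b'E; have /lattice_polyhedron := (zP i).1.
    by rewrite b'E; exact: (zP i).2.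
  have tb' : tight R A b'.
    by move=> i; exists (z i); rewrite same b'E; split => //; exact: (zP i).1.
  by exists b'; rewrite [RHS](integral _ tb') /integer_hull same.
have [|b' b'0] := @no_lattice_points_empty b.
  by move=> z Qz; apply: none; exists z.
exists b'; rewrite b'0 /integer_hull; apply/seteqP; split=> // x.
have -> : [set toR R z | z in lattice_points (polyhedron R A b)] = set0.
  by apply/seteqP; split=> // _ [z Qz <-]; apply: none; exists z.
exact: conv_set0.
Qed.

(** The description has the same rows, and tightness puts lattice points of the
hull on every hyperplane of the system, so its right-hand sides are not
smaller. *)
Lemma describes_integral b : describes_hull R A b 0 -> tight R A b ->
  integral_polyhedron (polyhedron R A b).
Proof.
move=> [p [M [b' [_ rowsM hull]]]] tb; apply/seteqP; split.
  move=> x /polyhedronP Qx; rewrite hull; apply/polyhedronP => k.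
  have [i _ ik] : rows A (row k M) by rewrite -[rows A]rowsM; exists k.
  have MA (z : 'cV[int]_n) : (M *m z) k 0 = (A *m z) i 0.
    by have := congr1 (fun r => (r *m z) 0 0) ik; rewrite -!row_mul !mxE.
  have -> : (toR R M *m x) k 0 = (AR *m x) i 0.
    have := congr1 (fun r => (toR R r *m x) 0 0) ik.
    by rewrite -!row_toR -!row_mul !mxE.
  apply: le_trans (Qx i) _; have [z [Qz <-]] := tb i.
  rewrite -MA ler_int; have : integer_hull (polyhedron R A b) (toR R z).
    exact: integer_hull_gen.
  by rewrite hull => /lattice_polyhedron.
exact: integer_hull_sub.
Qed.

(** The ranks are infima of sets of natural numbers, so they vanish only if zero
is attained. *)
Lemma scr_eq0 : scr R A = 0%E <-> forall b, describes_hull R A b 0.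
Proof.
have ge0 b : (0 <= scr_system R A b)%E.
  by apply/ereal_infP => _ [k _ <-]; rewrite lee_fin.
split=> [scr0 b|desc].
  have : (scr_system R A b <= 0)%E.
    by rewrite -scr0; apply: ereal_sup_ubound; exists b.
  rewrite leNgt => /negP h; apply: contrapT => nd; apply: h.
  apply: (@lt_le_trans _ _ 1%E); first by rewrite lte_fin.
  apply/ereal_infP => _ [[|k] dk <-]; first by case: nd.
  by rewrite lee_fin ler1n.
rewrite /scr; have -> : range (fun b => scr_system R A b) = [set 0%E].
  have E b : scr_system R A b = 0%E.
    apply/eqP; rewrite eq_le ge0 andbT; apply: ereal_inf_lbound.
    by exists 0%N => //; exact: desc.
  apply/seteqP; split=> y /=; first by move=> [b _ <-]; exact: E.
  by move=> ->; exists 0 => //; exact: E.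
exact: ereal_sup1.
Qed.

End Describes.

Theorem theorem3p5 (R : realType) (m n : nat) (A : 'M[int]_(m, n))
    (A_inj : injective (fun i : 'I_m => row i A))
    (A_prim : forall i : 'I_m, primitive_vec (row i A))
    (A_rank : \rank (toR R A) = n) :
  [<-> (* (1) *)
       supernormal R (rows A);
       (* (2) *)
       forall B : set 'rV[int]_n, basis_in R (rows A) B ->
         hilbert_basis (rows A `&` lattice_points (cone R B)) (cone R B);
       (* (2), second form *)
       rows A = ibn R A 1;
       (* (3), all triangulations *)
       forall T : {set {set 'I_m}},
         triangulation R A T -> uses_all T -> unimodular R A T;
       (* (3), regular triangulations *)
       forall T : {set {set 'I_m}},
         triangulation R A T -> regular_complex R A T -> uses_all T ->
         unimodular R A T;
       (* (4) *)
       forall b : 'cV[int]_m, tight R A b -> TDI R A b;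
       (* (5) *)
       forall b : 'cV[int]_m, tight R A b -> integral_polyhedron (polyhedron R A b);
       (* (6) *)
       scr R A = 0%E].
Proof.
have basisP := basis_hilbert R A_inj.
have ibnP := ibn1_basis A_inj A_prim A_rank.
have of_empty := stellar_hilbert A_inj A_prim (R := R).
have to_supernormal := basis_supernormal A_rank.
tfae.
- move=> sn; apply/basisP => s _ _; apply/hilbert_basis_rows.
  by apply: sn; exact: rowset_rows.
- by move/basisP/ibnP.
- by move/ibnP; exact: basis_unimodular.
- by move=> uni T Ttri _; exact: uni.
- move=> /(regular_unimodular_empty A_inj A_prim)/of_empty/to_supernormal.
  by move=> sn b; exact: supernormal_TDI.
- by move=> tdi b /tdi; exact: TDI_integral.
- by move=> integral; apply/scr_eq0; exact: integral_describes.
- move=> /scr_eq0 desc; apply: to_supernormal; apply: of_empty.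
  apply: integral_empty_hilbert => // b; exact: describes_integral (desc b).
Qed.
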